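(* Let $n\ge3$ and let $B_{1/e}\subseteq\mathbb R^n$ be the ball of radius $1/e$ centered at $0$. (i) The function $u(x)=-\ln|x|-1$ belongs to $W_0^{1,2}(B_{1/e})$ and solves $$-\Delta u+c\nabla u=0\ \text{ in }B_{1/e},\qquad c(x)=\frac{(n-2)x}{|x|^2}\in L^{n,\infty}(B_{1/e}),$$ and $u$ is not bounded in $B_{1/e}$. (ii) The function $v(x)=(-\ln|x|)^{-1}$ belongs to $W^{1,2}(B_{1/e})$ and solves $$-\Delta v+c'\nabla v=0\ \text{ in }B_{1/e},\qquad c'(x)=\frac{(n-2)x}{|x|^2}-\frac{2x}{|x|^2\ln|x|}\in L^{n,\infty}(B_{1/e}),$$ with $v(0)=0$ (in the sense that $v(x)\to0$ as $x\to0$) and $v$ not identically vanishing close to $0$. Consequently, for the operator $-\Delta u+c\nabla u$ with $c\in L^{n,\infty}$, without smallness of $\|c\|_{L^{n,\infty}}$ the boundedness of solutions required by the maximum principle and by Moser's and Harnack's estimates fails in general, and so does the reverse Moser estimate $\left(⨍_{B_r}w^a\right)^{1/a}\le C\inf_{B_{r/2}}w$ for nonnegative supersolutions $w$ (with $a>0$, $C<\infty$, and $B_r$ a ball centered at $0$).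
   Context: For measurable $h$ on $B_{1/e}$, $h^*(\tau)=\inf\{t>0:|\{x\in B_{1/e}:|h(x)|>t\}|\le\tau\}$ and $\|h\|_{L^{n,\infty}(B_{1/e})}=\sup_{\tau>0}\tau^{1/n}h^*(\tau)$; for vector valued $h$ use $|h|$. $W_0^{1,2}$ is the closure of $C_c^\infty$ in $W^{1,2}$. Solutions are weak: $u$ solves $-\Delta u+c\nabla u=0$ in $\Omega$ if $\int_\Omega\nabla u\cdot\nabla\phi+(c\cdot\nabla u)\phi=0$ for all $\phi\in C_c^\infty(\Omega)$; supersolutions are defined with $\ge0$ for all $0\le\phi\in C_c^\infty(\Omega)$. Infima are essential; $⨍_Bh=\frac1{|B|}\int_Bh$. *)

(* Defs.v *)
From HB Require Import structures.
From mathcomp Require Import all_boot all_order all_algebra.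
From mathcomp Require Import all_classical all_reals all_analysis ess_sup_inf.

Set Implicit Arguments.
Unset Strict Implicit.
Unset Printing Implicit Defensive.

Import Order.TTheory GRing.Theory Num.Theory.
Import numFieldNormedType.Exports.

Local Open Scope classical_set_scope.
Local Open Scope ring_scope.

(* Row vectors carry the sigma-algebra generated by the coordinates, i.e. the
   Borel sigma-algebra.  Lebesgue measure on 'rV_n.+1 is the image of the
   product of Lebesgue measures under R * 'rV_n -> 'rV_n.+1. *)

Section measurable_rV.
Context {R : realType} (n : nat).

Let coors : 'I_n -> 'rV[R]_n -> R := fun i x => x ord0 i.

Let rV_set0 : g_sigma_preimage coors set0.
Proof. exact: sigma_algebra0. Qed.

Let rV_setC A : g_sigma_preimage coors A -> g_sigma_preimage coors (~` A).
Proof. exact: sigma_algebraC. Qed.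

Let rV_bigcup (F : _^nat) : (forall i, g_sigma_preimage coors (F i)) ->
  g_sigma_preimage coors (\bigcup_i (F i)).
Proof. exact: sigma_algebra_bigcup. Qed.

HB.instance Definition _ :=
  @isMeasurable.Build (measure_tuple_display (sigma_display R.-ocitv.-measurable))
  'rV[R]_n (g_sigma_preimage coors) rV_set0 rV_setC rV_bigcup.

End measurable_rV.

Lemma measurable_coor (R : realType) n (i : 'I_n) :
  measurable_fun [set: 'rV[R]_n] (fun x : 'rV[R]_n => x ord0 i).
Proof.
move=> _ Y mY; rewrite setTI; apply: sub_sigma_algebra => /=.
rewrite -bigcup_seq/=; exists i => /=; first by rewrite mem_index_enum.
by exists Y => //; rewrite setTI.
Qed.

Lemma measurable_fun_coorP d (T : measurableType d) (R : realType) n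
    (f : T -> 'rV[R]_n) :
  (forall i, measurable_fun [set: T] (fun x => f x ord0 i)) ->
  measurable_fun [set: T] f.
Proof.
move=> mf _ Y mY; rewrite setTI.
have : (g_sigma_preimage (fun (i : 'I_n) (x : 'rV[R]_n) => x ord0 i)) `<=`
    [set A | d.-measurable (f @^-1` A)].
  apply: smallest_sub.
    split => /=.
    - by rewrite preimage_set0.
    - move=> A /= mA; rewrite setTD preimage_setC.
      exact: measurableC.
    - by move=> F mF /=; rewrite preimage_bigcup; exact: bigcup_measurable.
  rewrite -bigcup_seq => A [i /= _ [B mB <-]] /=.
  by rewrite setTI -[X in measurable X]setTI; exact: (mf i).
by apply; exact: mY.
Qed.

Section lebesgue_measure_step.
Context {R : realType} (n : nat).
Variable mu : {sigma_finite_measure set 'rV[R]_n -> \bar R}.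

Definition rV_cons (p : measurableTypeR R * 'rV[R]_n) : 'rV[R]_n.+1 :=
  row_mx (p.1)%:M p.2.

Lemma measurable_rV_cons : measurable_fun setT rV_cons.
Proof.
apply: measurable_fun_coorP => i.
rewrite /rV_cons.
case: (@splitP 1 n i) => j ij.
  rewrite (_ : (fun x => _) = fst); first exact: measurable_fst.
  apply/funext => x; rewrite (_ : i = lshift n j); last exact: val_inj.
  by rewrite (@row_mxEl _ 1 1 n) mxE !ord1 eqxx mulr1n.
rewrite (_ : (fun x => _) = (fun y : 'rV[R]_n => y ord0 j) \o snd).
  by apply: measurableT_comp; [exact: measurable_coor|exact: measurable_snd].
apply/funext => x; rewrite (_ : i = rshift 1 j); last exact: val_inj.
by rewrite (@row_mxEr _ 1 1 n).
Qed.

Definition lebesgue_rVS : set 'rV[R]_n.+1 -> \bar R :=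
  pushforward ((@lebesgue_measure R) \x mu)%E rV_cons.

Let lebesgue_rVS0 : lebesgue_rVS set0 = 0%E.
Proof. by rewrite /lebesgue_rVS /pushforward preimage_set0 measure0. Qed.

Let lebesgue_rVS_ge0 A : (0 <= lebesgue_rVS A)%E.
Proof. by rewrite /lebesgue_rVS /pushforward; exact: measure_ge0. Qed.

Let measurable_preimage_rV_cons A : measurable A ->
  measurable (rV_cons @^-1` A).
Proof. by move=> mA; rewrite -[X in measurable X]setTI; exact: measurable_rV_cons. Qed.

Let lebesgue_rVS_sigma_additive : semi_sigma_additive lebesgue_rVS.
Proof.
move=> F mF tF mUF; rewrite /lebesgue_rVS /pushforward preimage_bigcup.
apply: measure_semi_sigma_additive.
- by move=> k; exact: measurable_preimage_rV_cons.
- apply/trivIsetP => /= i j _ _ ij; rewrite -preimage_setI.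
  by move/trivIsetP : tF => /(_ _ _ _ _ ij) ->//; rewrite preimage_set0.
- by rewrite -preimage_bigcup; exact: measurable_preimage_rV_cons.
Qed.

HB.instance Definition _ := isMeasure.Build _ _ _ lebesgue_rVS
  lebesgue_rVS0 lebesgue_rVS_ge0 lebesgue_rVS_sigma_additive.

Let lebesgue_rVS_sigma_finite : sigma_finite setT lebesgue_rVS.
Proof.
pose uncons (x : 'rV[R]_n.+1) : measurableTypeR R * 'rV[R]_n :=
  (x ord0 ord0, \row_j x ord0 (lift ord0 j)).
have unconsK : cancel rV_cons uncons.
  move=> [a x]; rewrite /uncons /rV_cons; congr pair => /=.
    transitivity (@row_mx R 1 1 n a%:M x ord0 (lshift n ord0)).
      by congr fun_of_matrix; exact: val_inj.
    by rewrite row_mxEl mxE eqxx mulr1n.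
  apply/rowP => j; rewrite mxE.
  transitivity (@row_mx R 1 1 n a%:M x ord0 (rshift 1 j)).
    by congr fun_of_matrix; exact: val_inj.
  by rewrite row_mxEr.
have muncons : measurable_fun setT uncons.
  apply: measurable_fun_pair; first exact: measurable_coor.
  apply: measurable_fun_coorP => i.
  by under eq_fun do rewrite mxE; exact: measurable_coor.
have /sigma_finiteP[F [TF ndF Foo]] := sigma_finiteT (@lebesgue_measure R).
have /sigma_finiteP[G [TG ndG Goo]] := sigma_finiteT mu.
exists (fun k => uncons @^-1` (F k `*` G k)).
  rewrite -preimage_bigcup; apply/esym/seteqP; split => // z _ /=.
  have [k _ Fk] : (\bigcup_k F k) (uncons z).1 by rewrite -TF.
  have [l _ Gl] : (\bigcup_k G k) (uncons z).2 by rewrite -TG.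
  exists (maxn k l) => //; split.
    by move: Fk; exact/subsetPset/ndF/leq_maxl.
  by move: Gl; exact/subsetPset/ndG/leq_maxr.
move=> k; have [mFk Fk] := Foo k; have [mGk Gk] := Goo k; split.
  by rewrite -[X in measurable X]setTI; apply: muncons => //; exact: measurableX.
rewrite /lebesgue_rVS /pushforward -comp_preimage.
rewrite (_ : uncons \o rV_cons = id); last exact/funext/unconsK.
by rewrite preimage_id product_measure1E// lte_mul_pinfty// ge0_fin_numE.
Qed.

HB.instance Definition _ := Measure_isSigmaFinite.Build _ _ _ lebesgue_rVS
  lebesgue_rVS_sigma_finite.

End lebesgue_measure_step.

Fixpoint lebesgue_rV (R : realType) (n : nat) :
    {sigma_finite_measure set 'rV[R]_n -> \bar R} :=
  if n is m.+1 then lebesgue_rVS (lebesgue_rV R m) else \d_(0 : 'rV[R]_0).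

(* The norm `|x| of 'rV[R]_n is the sup norm, hence the separate Euclidean norm
   [enorm]; both induce the same topology. *)

Section euclidean.
Context {R : realType} {n : nat}.
Implicit Types (x y : 'rV[R]_n) (f phi : 'rV[R]_n -> R).

Definition dotrv x y : R := \sum_(i < n) x ord0 i * y ord0 i.

Definition enorm x : R := Num.sqrt (dotrv x x).

Definition eball (r : R) : set 'rV[R]_n := [set x | enorm x < r].

Definition partial (i : 'I_n) f : 'rV[R]_n -> R := 'D_(delta_mx ord0 i) f.

Definition grad f : 'rV[R]_n -> 'rV[R]_n := fun x => \row_i partial i f x.

Definition iter_partial (s : seq 'I_n) f := foldr partial f s.

Definition smooth f : Prop := forall s : seq 'I_n,
  continuous (iter_partial s f) /\
  forall (i : 'I_n) x, derivable (iter_partial s f) x (delta_mx ord0 i).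

Definition Cc_infty (D : set 'rV[R]_n) phi : Prop :=
  [/\ smooth phi, compact (closure [set x | phi x != 0])
    & closure [set x | phi x != 0] `<=` D].

End euclidean.

Section sobolev.
Context {R : realType} {n : nat}.
Implicit Types (D : set 'rV[R]_n) (u f phi : 'rV[R]_n -> R)
  (g c : 'rV[R]_n -> 'rV[R]_n).
Local Notation mu := (lebesgue_rV R n).

Definition L2 D f : Prop :=
  measurable_fun D f /\ (\int[mu]_(x in D) (f x ^+ 2)%:E < +oo)%E.

Definition L1loc D f : Prop :=
  forall K, compact K -> K `<=` D -> mu.-integrable K (EFin \o f).

Definition weak_gradient D u g : Prop :=
  [/\ L1loc D u, forall i, L1loc D (fun x => g x ord0 i) &
    forall phi, Cc_infty D phi -> forall i,
      \int[mu]_(x in D) (u x * partial i phi x) =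
      - \int[mu]_(x in D) (g x ord0 i * phi x)].

Definition W12_with D u g : Prop :=
  [/\ L2 D u, forall i, L2 D (fun x => g x ord0 i) & weak_gradient D u g].

Definition W12 D u : Prop := exists g, W12_with D u g.

Definition W12_norm D u g : \bar R :=
  ((\int[mu]_(x in D) (u x ^+ 2)%:E +
    \int[mu]_(x in D) (enorm (g x) ^+ 2)%:E) `^ 2^-1)%E.

Definition W12_0 D u : Prop := exists2 g, W12_with D u g &
  forall eps : R, 0 < eps -> exists2 phi, Cc_infty D phi &
    (W12_norm D (u \- phi)%R (fun x => g x - grad phi x)%R < eps%:E)%E.

(* With g the weak gradient of u, the integrand of the weak form of
   - Delta u + c . nabla u, tested against phi. *)
Definition weak_form c g phi : 'rV[R]_n -> R :=
  fun x => dotrv (g x) (grad phi x) + dotrv (c x) (g x) * phi x.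

Definition weak_solution D c u : Prop := exists2 g, weak_gradient D u g &
  forall phi, Cc_infty D phi ->
    mu.-integrable D (EFin \o weak_form c g phi) /\
    \int[mu]_(x in D) weak_form c g phi x = 0.

Definition weak_supersolution D c u : Prop := exists2 g, weak_gradient D u g &
  forall phi, Cc_infty D phi -> (forall x, 0 <= phi x) ->
    mu.-integrable D (EFin \o weak_form c g phi) /\
    0 <= \int[mu]_(x in D) weak_form c g phi x.

Definition ess_bounded D u : Prop :=
  exists M : R, \forall x \ae mu, D x -> `|u x| <= M.

(* [ess_inf] is taken over the whole space, hence the value +oo off D *)
Definition ess_inf_on D u : \bar R :=
  ess_inf mu (patch (cst +oo%E) D (EFin \o u)).

(* (average over D of u^a)^(1/a), for u >= 0 and a > 0 *)
Definition power_mean (a : R) D u : \bar R :=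
  (((mu D)^-1 * \int[mu]_(x in D) (u x `^ a)%:E) `^ a^-1)%E.

End sobolev.

(* In the Lorentz (quasi-)norm of L^{n,oo}, the exponent n is the dimension. *)

Section weak_Ln.
Context {R : realType} {n : nat}.
Implicit Types (D : set 'rV[R]_n) (h : 'rV[R]_n -> R)
  (c : 'rV[R]_n -> 'rV[R]_n).
Local Notation mu := (lebesgue_rV R n).

Definition rearrangement D h (tau : R) : \bar R :=
  ereal_inf [set t%:E | t in
    [set t : R | 0 < t /\ (mu (D `&` [set x | (t < `|h x|)%R]) <= tau%:E)%E]].

Definition weak_Ln_norm D h : \bar R :=
  ereal_sup [set ((tau `^ n%:R^-1)%R%:E * rearrangement D h tau)%E
            | tau in [set tau : R | 0 < tau]].

Definition weak_Ln D c : Prop :=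
  measurable_fun D c /\ (weak_Ln_norm D (enorm \o c) < +oo)%E.

End weak_Ln.

(* Since ln 0 = 0 and 0^-1 = 0, these total functions take the values -1, 0, 0, 0
   at the origin, a null set. *)

Section examples.
Context {R : realType} {n : nat}.
Implicit Types x : 'rV[R]_n.

Definition einv : R := (expR 1)^-1.

Definition u_ex x : R := - ln (enorm x) - 1.

Definition c_ex x : 'rV[R]_n := ((n%:R - 2) / enorm x ^+ 2) *: x.

Definition v_ex x : R := (- ln (enorm x))^-1.

Definition c'_ex x : 'rV[R]_n :=
  ((n%:R - 2) / enorm x ^+ 2) *: x
  - (2 / (enorm x ^+ 2 * ln (enorm x))) *: x.

End examples.

(* Main.v *)
Require Import Defs.
From mathcomp Require Import all_boot all_order all_algebra.
From mathcomp Require Import all_classical all_reals all_analysis.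
From mathcomp Require Import measurable_realfun ess_sup_inf.
From mathcomp Require Import ring lra.

Import Order.TTheory GRing.Theory Num.Theory.
Import numFieldNormedType.Exports.

Local Open Scope classical_set_scope.
Local Open Scope ring_scope.

Set Implicit Arguments.
Unset Strict Implicit.
Unset Printing Implicit Defensive.

(* Both u and v are functions of |x|^2, smooth away from the origin, where the
   two equations are pointwise identities: c . grad u is the divergence of
   grad u, and likewise for v.  The singularities of u, v, their gradients and
   the divergences of these are all O(|x|^-2), which is integrable in dimension
   n >= 3.  Hence replacing |x|^2 by |x|^2 + eta, integrating by parts against a
   test function and letting eta tend to 0 (dominated convergence) shows that no
   mass concentrates at the origin: the classical gradients are weak gradients
   and the equations hold weakly in the whole ball.  For u in W^{1,2}_0 take
   u_eta = - ln(|x|^2 + eta) / 2 - 1, which is negative near the boundary, and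
   approximate u by u_eta exp(- eta / u_eta) on {u_eta > 0}.  The coefficients
   are O(1 / |x|), hence in weak L^n.  Finally u is unbounded at 0, and v > 0
   has essential infimum 0 on each ball centered at 0, which contradicts the
   reverse Moser estimate. *)

(** * Borel sets and balls of ['rV[R]_n] *)

(** The coefficients are never regularized: they enter only through the identity [c . g = div g], so
    only the field [g] has to be smoothed. With this identity the weak form is the sum of the
    derivatives of [phi g_i], and no flux through a small sphere has to be estimated. The measure is
    an iterated product, in which Fubini treats one coordinate at a time; hence integration by parts
    is done coordinatewise and not through a divergence theorem on balls. The shift needs room:
    [|x|^2 + eta] must stay below some [S > r^2] where the profiles are regular. For [r = 1/e] the
    choice is [S = 1/e], because [s < 1/e] still gives [ln s < -1], away from the zero of the
    logarithm at [s = 1]. *)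

Section borel_rV.
Context {R : realType} {n : nat}.
Implicit Types x y : 'rV[R]_n.

Lemma measurable_ball_rV x (e : R) : measurable (ball x e).
Proof.
(* The ball of a row vector includes the condition [0 < e]; without this case the intersection below
   would be wrong for [n = 0]. *)
have [e0|e0] := ltP 0 e; last first.
  rewrite (_ : ball x e = set0) ?measurable0//.
  by apply/seteqP; split => // y [] /(le_lt_trans e0); rewrite ltxx.
rewrite (_ : ball x e = \bigcap_(i in [set: 'I_n])
    ((fun y : 'rV[R]_n => y ord0 i) @^-1` ball (x ord0 i) e)).
  apply: fin_bigcap_measurable => // i _.
  rewrite -[X in measurable X]setTI; apply: measurable_coor => //.
  exact: measurable_ball.
apply/seteqP; split => [y [_ xy] i _|y xy]; first exact: xy.
by split=> // i j; rewrite ord1; exact: xy.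
Qed.

(** The sigma-algebra is generated by the coordinates, so open sets have to be recovered: an open
    set is the union of the countably many balls with rational centre and radius [1/(k+1)] that it
    contains. *)
Lemma measurable_open_rV (U : set 'rV[R]_n) : open U -> measurable U.
Proof.
move=> oU.
pose F (p : 'rV[rat]_n * nat) : set 'rV[R]_n :=
  ball (map_mx ratr p.1 : 'rV[R]_n) p.2.+1%:R^-1.
rewrite (_ : U = \bigcup_(p in [set p | F p `<=` U]) F p).
  rewrite bigcup_mkcond; apply: countable_bigcupT_measurable.
    exact: (@countableP ('rV[rat]_n * nat)%type).
  by move=> p; case: ifP => // _; exact: measurable_ball_rV.
apply/seteqP; split => [x Ux|x [p pU]]; last exact: pU.
move: oU; rewrite openE => /(_ _ Ux)/nbhs_ballP[e /= e0 xeU].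
(* Twice the radius is less than [e], so a ball of this radius that contains [x] lies in
   [ball x e]. *)
have [k ke] : exists k : nat, k.+1%:R^-1 + k.+1%:R^-1 < e.
  have /ltr_add_invr[k] : 0 < e / 2 by rewrite divr_gt0.
  rewrite add0r => ke; exists k; by rewrite (splitr e) ltrD.
have kgt0 : 0 < k.+1%:R^-1 :> R by rewrite invr_gt0.
have /choice[q xq] i : exists q : rat, ratr q \in `]x ord0 i, x ord0 i + k.+1%:R^-1[.
  by apply: rat_in_itvoo; rewrite ltrDl.
have xb : F (\row_i q i, k) x.
  split=> //= i j; rewrite ord1 !mxE /ball/=.
  have := xq j; rewrite in_itv/= => /andP[q1 q2].
  move: (ratr _) (_^-1) q1 q2 => a b q1 q2.
  by rewrite ltr_distl; apply/andP; split; lra.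
exists (\row_i q i, k) => //= y qy; apply: xeU.
by apply: le_ball (ltW ke) _ _; apply: ball_triangle qy; exact: ball_sym.
Qed.

Lemma measurable_compact_rV (K : set 'rV[R]_n) : compact K -> measurable K.
Proof.
move=> /(compact_closed (@norm_hausdorff _ _)) cK.
rewrite -(setCK K); apply: measurableC; apply: measurable_open_rV.
by rewrite openC.
Qed.

Lemma continuous_measurable_rV (f : 'rV[R]_n -> R) :
  continuous f -> measurable_fun setT f.
Proof.
move=> /continuousP cf; apply: (measurability _ (RGenOpens.measurableE R)).
move=> _ [_ [a [b ->] <-]]; rewrite setTI; apply: measurable_open_rV.
exact/cf/interval_open.
Qed.

Lemma coor_continuous (i : 'I_n) : continuous (fun x : 'rV[R]_n => x ord0 i).
Proof. exact: coord_continuous. Qed.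

End borel_rV.

(** * The Euclidean norm compared with the coordinates *)

Section enorm_theory.
Context {R : realType} {n : nat}.
Implicit Types x y : 'rV[R]_n.

Lemma dotrv_ge0 x : 0 <= dotrv x x.
Proof. by apply: sumr_ge0 => i _; rewrite -expr2 sqr_ge0. Qed.

Lemma enorm_ge0 x : 0 <= enorm x.
Proof. exact: sqrtr_ge0. Qed.

Lemma sqr_enorm x : enorm x ^+ 2 = dotrv x x.
Proof. by rewrite sqr_sqrtr// dotrv_ge0. Qed.

Lemma dotrvv_continuous : continuous (fun x : 'rV[R]_n => dotrv x x).
Proof.
apply: continuous_big => [|i _ x]; first exact: add_continuous.
by apply: (@continuousM R 'rV[R]_n (fun y => y ord0 i) (fun y => y ord0 i));
  exact: coor_continuous.
Qed.

Lemma enorm_continuous : continuous (@enorm R n).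
Proof.
move=> x; apply: continuous_comp; first exact: dotrvv_continuous.
exact: sqrt_continuous.
Qed.

Lemma measurable_enorm : measurable_fun setT (@enorm R n).
Proof. by apply: continuous_measurable_rV; exact: enorm_continuous. Qed.

Lemma coor_le_enorm x i : `|x ord0 i| <= enorm x.
Proof.
rewrite -sqrtr_sqr ler_wsqrtr// /dotrv (bigD1 i)//= expr2 lerDl.
by apply: sumr_ge0 => j _; rewrite -expr2 sqr_ge0.
Qed.

Lemma enorm_le_sum x : enorm x <= \sum_i `|x ord0 i|.
Proof.
have s0 : 0 <= \sum_i `|x ord0 i| by exact: sumr_ge0.
rewrite -(ler_pXn2r (n:=2))// ?nnegrE// ?enorm_ge0// sqr_enorm expr2 mulr_suml.
apply: ler_sum => i _; rewrite -expr2 -real_normK ?num_real// expr2.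
by rewrite ler_wpM2l// (bigD1 i)//= lerDl; exact: sumr_ge0.
Qed.

Lemma enorm_eq0 x : (enorm x == 0) = (x == 0).
Proof.
apply/idP/eqP => [/eqP x0|->].
  apply/rowP => i; rewrite mxE; apply/normr0_eq0/le_anti.
  by rewrite normr_ge0 andbT -x0 coor_le_enorm.
by rewrite -sqrf_eq0 sqr_enorm /dotrv big1// => i _; rewrite mxE mul0r.
Qed.

Lemma enorm0 : enorm (0 : 'rV[R]_n) = 0.
Proof. by apply/eqP; rewrite enorm_eq0. Qed.

Lemma enorm_gt0 x : (0 < enorm x) = (x != 0).
Proof. by rewrite lt0r enorm_eq0 enorm_ge0 andbT. Qed.

Lemma open_eball r : open (eball r : set 'rV[R]_n).
Proof.
rewrite /eball (_ : [set x | _] = @enorm R n @^-1` [set t | t < r])//.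
apply: open_comp; last exact: open_lt.
by move=> x _; exact: enorm_continuous.
Qed.

Lemma measurable_eball r : measurable (eball r : set 'rV[R]_n).
Proof. by apply: measurable_open_rV; exact: open_eball. Qed.

End enorm_theory.

(** * Lebesgue measure of cubes and Euclidean balls *)

Section measure_balls.
Context {R : realType}.

Lemma lebesgue_rVSE n (A : set 'rV[R]_n.+1) :
  lebesgue_rV R n.+1 A =
  ((@lebesgue_measure R) \x lebesgue_rV R n)%E (@rV_cons R n @^-1` A).
Proof. by []. Qed.

Lemma rV_cons0 n (p : measurableTypeR R * 'rV[R]_n) : rV_cons p ord0 ord0 = p.1.
Proof.
rewrite /rV_cons (_ : ord0 = lshift n (ord0 : 'I_1)); last exact: val_inj.
by rewrite (@row_mxEl _ 1 1 n) mxE eqxx mulr1n.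
Qed.

Lemma rV_cons_lift n (p : measurableTypeR R * 'rV[R]_n) j :
  rV_cons p ord0 (lift ord0 j) = p.2 ord0 j.
Proof.
rewrite /rV_cons (_ : lift ord0 j = rshift 1 j); last exact: val_inj.
by rewrite (@row_mxEr _ 1 1 n).
Qed.

Definition cube n (a : R) : set 'rV[R]_n := [set x | forall i, `|x ord0 i| < a].

Lemma measurable_cube n a : measurable (@cube n a).
Proof.
rewrite (_ : @cube n a = \bigcap_(i in [set: 'I_n])
    ((fun y : 'rV[R]_n => y ord0 i) @^-1` ball 0 a)).
  apply: fin_bigcap_measurable => // i _.
  rewrite -[X in measurable X]setTI; apply: measurable_coor => //.
  exact: measurable_ball.
apply/seteqP; split => [y ya i _|y ya i].
  by rewrite /preimage/= /ball/= sub0r normrN; exact: ya.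
by have := ya i Logic.I; rewrite /preimage/= /ball/= sub0r normrN.
Qed.

Lemma lebesgue_rV_cube n a : 0 <= a ->
  lebesgue_rV R n (@cube n a) = ((2 * a) ^+ n)%:E.
Proof.
move=> a0; elim: n => [|n ih].
  rewrite /= (_ : cube _ = setT) ?expr0 ?diracT//.
  by apply/seteqP; split => // x _ [].
rewrite lebesgue_rVSE (_ : @rV_cons R n @^-1` cube a = ball 0 a `*` @cube n a).
  rewrite product_measure1E//; [|exact: measurable_ball|exact: measurable_cube].
  rewrite ih; have [->|/eqP ane0] := eqVneq a 0.
    rewrite mulr0 (_ : ball _ _ = set0) ?measure0 ?mul0e ?expr0n//.
    by apply/seteqP; split => // x; rewrite /ball/= => /(le_lt_trans (normr_ge0 _)); rewrite ltxx.
  rewrite [X in (X * _)%E](_ : _ = (a *+ 2)%:E); last exact: lebesgue_measure_ball.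
  by rewrite exprS -(mulr_natl a) -EFinM.
apply/seteqP; split => [[t x] tx|[t x] [/= ta xa] i].
  split; first by have := tx ord0; rewrite rV_cons0 /ball/= sub0r normrN.
  by move=> j; have := tx (lift ord0 j); rewrite rV_cons_lift.
case: (unliftP ord0 i) => [j ->|->]; first by rewrite rV_cons_lift; exact: xa.
by rewrite rV_cons0; move: ta; rewrite /ball/= sub0r normrN.
Qed.

Context {n : nat}.
Local Notation mu := (lebesgue_rV R n).

Lemma eball_sub_cube r : (eball r : set 'rV[R]_n) `<=` @cube n r.
Proof. by move=> x xr i; exact: le_lt_trans (coor_le_enorm _ _) xr. Qed.

(** The order [r^n] is all that the estimates use, so the circumscribed cube replaces the exact
    volume. *)
Lemma lebesgue_rV_eball_le r : 0 <= r ->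
  (mu (eball r) <= ((2 * r) ^+ n)%:E)%E.
Proof.
move=> r0; rewrite -lebesgue_rV_cube//; apply: le_measure.
- by rewrite inE; exact: measurable_eball.
- by rewrite inE; exact: measurable_cube.
- exact: eball_sub_cube.
Qed.

Lemma lebesgue_rV_eball_gt0 r : 0 < r -> (0 < mu (eball r))%E.
Proof.
move=> r0; have s0 : 0 < r / n.+1%:R by rewrite divr_gt0.
apply: (@lt_le_trans _ _ (mu (@cube n (r / n.+1%:R)))).
  by rewrite lebesgue_rV_cube ?ltW// lte_fin exprn_gt0// mulr_gt0.
apply: le_measure; rewrite ?inE.
- exact: measurable_cube.
- exact: measurable_eball.
- move=> x xr; apply: le_lt_trans (enorm_le_sum x) _.
  apply: (@le_lt_trans _ _ (\sum_(i < n) (r / n.+1%:R))).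
    by apply: ler_sum => i _; exact: ltW.
  rewrite sumr_const card_ord -(mulr_natl (r / _)) mulrCA -[ltRHS]mulr1 ltr_pM2l//.
  by rewrite ltr_pdivrMr// mul1r ltr_nat.
Qed.

Lemma lebesgue_rV_eball_fin r : (mu (eball r) < +oo)%E.
Proof.
have [r0|r0] := leP 0 r.
  by apply: le_lt_trans (lebesgue_rV_eball_le r0) _; rewrite ltry.
rewrite (_ : eball r = set0) ?measure0//.
apply/seteqP; split => // x /(le_lt_trans (enorm_ge0 x)) /lt_trans/(_ r0).
by rewrite ltxx.
Qed.

Lemma lebesgue_rV_singleton0 : (0 < n)%N -> mu [set 0] = 0.
Proof.
move=> n0; apply/eqP; rewrite eq_le measure_ge0 andbT.
have m0 : measurable [set (0 : 'rV[R]_n)].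
  apply: measurable_compact_rV; exact: compact_set1.
have h (r : R) : 0 < r -> (mu [set 0%R] <= ((2 * r) ^+ n)%:E)%E.
  move=> r0; apply: le_trans (lebesgue_rV_eball_le (ltW r0)).
  apply: le_measure; rewrite ?inE//; first exact: measurable_eball.
  by move=> x ->; rewrite /eball/= enorm0.
apply/lee_addgt0Pr => e e0; rewrite add0e.
(* [2 r <= 1] gives [(2 r)^n <= 2 r], and [2 r <= e] then bounds it by [e]. *)
pose r := Order.min (e / 2) 2^-1.
have r0 : 0 < r by rewrite lt_min divr_gt0//= invr_gt0.
apply: le_trans (h _ r0) _; rewrite lee_fin.
have r1 : 2 * r <= 1 by rewrite -ler_pdivlMl// mulr1 ge_min lexx orbT.
have re : 2 * r <= e by rewrite -ler_pdivlMl// mulrC ge_min lexx.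
apply: le_trans re; rewrite -[leRHS]expr1; apply: ler_wiXn2l => //.
by rewrite mulr_ge0// ltW.
Qed.

Lemma ae_neq0 : (0 < n)%N -> \forall x \ae mu, x != 0 :> 'rV[R]_n.
Proof.
move=> n0; exists [set 0]; split => //; last first.
  by move=> x /= /negP; rewrite negbK => /eqP.
- exact: lebesgue_rV_singleton0.
- apply: measurable_compact_rV; exact: compact_set1.
Qed.

End measure_balls.

(** Inversion is discontinuous at 0, but it equals [x * (x^2)^(-1)] with a measurable real power,
    also at 0, where both sides are 0. *)
Lemma measurable_invr (R : realType) : measurable_fun setT (@GRing.inv R).
Proof.
rewrite (_ : GRing.inv = fun x : R => x * (x ^+ 2) `^ (- 1)).
  apply: measurable_funM => //.
  apply: (@measurableT_comp _ _ _ _ _ _ (fun y : R => y `^ (- 1))).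
    exact: measurable_powR.
  exact: measurable_funX.
apply/funext => x; rewrite powR_inv1 ?sqr_ge0//.
by have [->|x0] := eqVneq x 0; [rewrite invr0 mul0r|rewrite expr2 invfM mulVKf].
Qed.

Lemma measurable_funV d (T : measurableType d) (R : realType) (D : set T)
  (f : T -> R) : measurable_fun D f -> measurable_fun D (fun x => (f x)^-1).
Proof. by move=> mf; apply: measurableT_comp => //; exact: measurable_invr. Qed.

(** * Integrability of [|x|^-2] in dimension at least three *)

Section integrable_singularity.
Context {R : realType} {n : nat}.
Local Notation mu := (lebesgue_rV R n).

(** The least [m] with [2^-m <= t] is positive because [t < 1]; take [k = m - 1]. *)
Let dyadic (t : R) : 0 < t < 1 ->
  exists k, t < 2^-1 ^+ k /\ (t ^+ 2)^-1 <= 4 ^+ k.+1.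
Proof.
move=> /andP[t0 t1].
have ex : exists k, 2^-1 ^+ k <= t.
  have [k] := ltr_add_invr t0; rewrite add0r => /ltW kt; exists k.
  apply: le_trans kt; rewrite exprVn lef_pV2 ?posrE ?exprn_gt0//.
  by rewrite -natrX ler_nat ltn_expl.
have [k kt kmin] := ex_minnP ex.
case: k kt kmin => [|k] kt kmin; first by move: kt; rewrite expr0 leNgt t1.
exists k; split; first by rewrite ltNge; apply/negP => /kmin; rewrite ltnn.
have -> : 4 ^+ k.+1 = ((2^-1 ^+ k.+1) ^+ 2)^-1 :> R.
  by rewrite -exprM mulnC exprM exprVn expr2 -natrM exprVn invrK.
by rewrite lef_pV2 ?posrE ?exprn_gt0 ?invr_gt0// lerXn2r// ?nnegrE ?exprn_ge0 ?invr_ge0 ?ltW.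
Qed.

(* On the dyadic annulus [2^-(k+1) <= |x| < 2^-k] the integrand is at most
   [4^(k+1)] and the ball has measure at most [2^n 8^-k]. *)
Lemma integrable_inv_sqr_enorm : (3 <= n)%N ->
  mu.-integrable (eball 1) (fun x => (enorm x ^+ 2)^-1%:E).
Proof.
move=> n3; apply/integrableP; split.
  apply/measurable_EFinP; apply: measurable_funTS; apply: measurable_funV.
  by apply: measurable_funX; exact: measurable_enorm.
pose F (k : nat) (x : 'rV[R]_n) : \bar R :=
  ((4 ^+ k.+1)%:E * (\1_(eball (2^-1 ^+ k)) x)%:E)%E.
have F0 k x : (0 <= F k x)%E by rewrite /F mule_ge0// lee_fin ?exprn_ge0.
have mF k : measurable_fun (eball 1) (F k).
  apply/measurable_EFinP; apply: measurable_funM => //.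
  by apply: measurable_indic; exact: measurable_eball.
apply: (@le_lt_trans _ _ (\int[mu]_(x in eball 1) \sum_(0 <= k <oo) F k x)%E).
  apply: ge0_le_integral => //=.
  - exact: measurable_eball.
  - do 2 apply: measurableT_comp => //.
    apply: measurable_funTS; apply: measurable_funV.
    by apply: measurable_funX; exact: measurable_enorm.
  - by apply: ge0_emeasurable_sum => // k *; exact: F0.
  - move=> x x1; have [->|x0] := eqVneq x 0.
      rewrite enorm0.
      by rewrite expr0n/= invr0 normr0; exact: nneseries_ge0.
    have [k [xk kx]] : exists k, enorm x < 2^-1 ^+ k /\ (enorm x ^+ 2)^-1 <= 4 ^+ k.+1.
      by apply: dyadic; rewrite enorm_gt0 x0.
    rewrite ger0_norm ?invr_ge0 ?sqr_ge0//.
    apply: (@le_trans _ _ (F k x)).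
      by rewrite /F indicE mem_set// mule1 lee_fin.
    rewrite (nneseries_split 0 k.+1)//; apply: le_trans (leeDl _ _); last first.
      exact: nneseries_ge0.
    by rewrite add0n big_nat_recr//= leeDr// sume_ge0.
rewrite integral_nneseries//; last exact: measurable_eball.
(* The product of the two bounds, [4^(k+1) 2^n 8^-k = 4 2^n 2^-k], written with [2^(k+1)] in the
   denominator as a standard geometric series. *)
apply: (@le_lt_trans _ _ (\sum_(0 <= k <oo) ((4 * 2 ^+ n.+1) / (2 ^ k.+1)%:R)%:E)%E); last first.
  apply: le_lt_trans (epsilon_trick0 _ _) _; last exact: ltry.
  by rewrite mulr_ge0// exprn_ge0.
apply: lee_nneseries => [k _ _|k _]; first by apply: integral_ge0 => x _; exact: F0.
rewrite /F ge0_integralZl//; last 2 first.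
- exact: measurable_eball.
- apply/measurable_EFinP; apply: measurable_indic; exact: measurable_eball.
rewrite integral_indic//; [|exact: measurable_eball..].
apply: (@le_trans _ _ ((4 ^+ k.+1)%:E * ((2 * 2^-1 ^+ k) ^+ n)%:E)%E).
  apply: lee_wpmul2l; first by rewrite lee_fin exprn_ge0.
  apply: le_trans (lebesgue_rV_eball_le _); last by rewrite exprn_ge0// invr_ge0.
  apply: le_measure; rewrite ?inE//; [|exact: measurable_eball].
  by apply: measurableI; exact: measurable_eball.
rewrite -EFinM lee_fin exprMn natrX.
have E2 : 2 ^+ k = (2^-1 ^+ k)^-1 :> R by rewrite exprVn invrK.
have E4 : 4 ^+ k = (2^-1 ^+ k)^-1 ^+ 2 :> R.
  by rewrite -E2 -exprM mulnC exprM expr2 -natrM.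
rewrite !(exprS _ k) E2 E4 (exprS _ n).
have q0 : 0 < 2^-1 ^+ k :> R by rewrite exprn_gt0.
have q1 : 2^-1 ^+ k <= 1 :> R by rewrite exprn_ile1 ?invr_ge0// invf_le1// ler1n.
set q : R := 2^-1 ^+ k in q0 q1 *.
(* The dimension enters here: [q^-2 q^n <= q] requires [n >= 3]. *)
have qn : q ^+ n <= q ^+ 3 by rewrite ler_wiXn2l// ltW.
rewrite [leRHS](_ : _ = 4 * q^-1 ^+ 2 * (2 ^+ n * q ^+ 3)); last first.
  by field; rewrite gt_eqF.
rewrite ler_pM2l ?mulr_gt0 ?exprn_gt0 ?invr_gt0//.
by rewrite ler_pM2l// exprn_gt0.
Qed.

End integrable_singularity.

(** * Integration by parts *)

Lemma bounded_support_integrable d (T : measurableType d) (R : realType)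
    (m : {measure set T -> \bar R}) (A : set T) (g : T -> R) (M : R) :
  measurable A -> (m A < +oo)%E -> measurable_fun setT g ->
  (forall x, `|g x| <= M) -> (forall x, ~ A x -> g x = 0) ->
  m.-integrable setT (EFin \o g).
Proof.
move=> mA Aoo mg gM gA.
rewrite (_ : EFin \o g = (EFin \o g) \_ A).
  apply/(integrable_mkcond _ mA); apply: measurable_bounded_integrable => //.
    exact: measurable_funTS.
  exists M; split; first exact: num_real.
  by move=> y My x Ax /=; apply: le_trans (gM x) _; exact: ltW.
apply/funext => x; rewrite patchE; case: ifPn => // /negP xA.
by rewrite /= gA// => Ax; apply: xA; rewrite inE.
Qed.

(** The two difference quotients are the same function of [h]. This brings directional derivatives
    within reach of the one-variable chain rule and of slicing along coordinates. *)
Lemma is_derive_line (R : numFieldType) (V W : normedModType R) (f : V -> W)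
    (x v : V) (l : W) :
  is_derive x v f l <-> is_derive (0 : R) (1 : R) (fun h => f (h *: v + x)) l.
Proof.
have E : (fun h : R => h^-1 *: ((f \o shift x) (h *: v) - f x)) =
  (fun h => h^-1 *: (((fun h => f (h *: v + x)) \o shift 0) (h *: 1) -
    (fun h => f (h *: v + x)) 0)).
  apply/funext => h /=; congr (_ *: (f _ - f _)); last by rewrite scale0r add0r.
  by congr (_ *: _ + _); rewrite addr0 /GRing.scale/= mulr1.
split=> -[d e]; split.
- exact: (derivable1P f x v).1.
- by rewrite -e /derive E.
- exact: (derivable1P f x v).2.
- by rewrite -e /derive E.
Qed.

Section partial_lemmas.
Context {R : realType} {n : nat}.
Implicit Types (f g : 'rV[R]_n -> R).

Lemma compact_ccube (M : R) : compact [set x : 'rV[R]_n | forall i, `|x ord0 i| <= M].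
Proof.
rewrite [X in compact X](_ : _ =
    [set v : 'rV[R]_n | forall i, `[- M, M]%classic (v ord0 i)]).
  by apply: (@rV_compact _ _ (fun=> `[- M, M]%classic)) => _; exact: segment_compact.
by apply/seteqP; split => x /= xM i; have := xM i; rewrite in_itv/= ler_norml.
Qed.

Lemma cube_support_bounded g M : continuous g -> (forall x, ~ cube M x -> g x = 0) ->
  exists K, forall x, `|g x| <= K.
Proof.
move=> cg g0.
have /compact_bounded[K [_ gK]] : compact (g @` [set x : 'rV[R]_n | forall i, `|x ord0 i| <= M]).
  apply: continuous_compact; last exact: compact_ccube.
  exact: continuous_subspaceT.
exists (Order.max 0 (K + 1)) => x.
have [xM|xM] := pselect (cube M x); last by rewrite g0// normr0 le_max lexx.
rewrite le_max; apply/orP; right; apply: gK; first by rewrite ltrDl.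
by exists x => // i; exact/ltW/xM.
Qed.

Lemma partialE f i x (l : R) : is_derive x (delta_mx ord0 i) f l -> partial i f x = l.
Proof. by move=> [_ <-]. Qed.

Lemma partial_locally0 f i x : (\forall y \near x, f y = 0) ->
  is_derive x (delta_mx ord0 i) f 0.
Proof.
move=> f0; apply: (@near_eq_is_derive _ _ _ (cst 0)).
by apply: filterS f0 => y ->.
Qed.

(** Outside the cube enlarged by 1, the unit sup-norm ball around [x] misses the smaller cube.
    Vanishing on a neighbourhood, and not merely at [x], is what passes to derivatives. *)
Lemma notin_cube_near0 f M x : (forall y, ~ cube M y -> f y = 0) ->
  ~ cube (M + 1) x -> \forall y \near x, f y = 0.
Proof.
move=> f0 xM.
have [i xi] : exists i, M + 1 <= `|x ord0 i|.
  apply: contrapT => h; apply: xM => i; rewrite ltNge; apply/negP => xi.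
  by apply: h; exists i.
apply: filterS (nbhsx_ballx x 1 ltr01) => y [_ /(_ ord0 i)].
rewrite /ball/= => xy; apply: f0 => /(_ i).
by have := lerB_dist (x ord0 i) (y ord0 i); lra.
Qed.

End partial_lemmas.

Lemma continuous_rV (T : topologicalType) (R : realType) n (g : T -> 'rV[R]_n) :
  (forall i, continuous (fun t => g t ord0 i)) -> continuous g.
Proof.
move=> cg t A [P gP PA].
apply: (@filterS _ (nbhs t) _ (fun s => forall i, P ord0 i (g s ord0 i))).
  by move=> s sP; apply: PA => i j; rewrite ord1; exact: sP.
by apply: filter_forall => i; apply: cg; exact: gP.
Qed.

Section int_partial.
Context {R : realType}.

Lemma rV_cons_shift0 n (p : measurableTypeR R * 'rV[R]_n) (h : R) :
  h *: delta_mx ord0 ord0 + rV_cons p = rV_cons (h + p.1, p.2).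
Proof.
apply/rowP => i; rewrite mxE; case: (unliftP ord0 i) => [j ->|->].
  by rewrite !rV_cons_lift !mxE mulr0 add0r.
by rewrite !rV_cons0 !mxE eqxx mulr1.
Qed.

Lemma rV_cons_shift_lift n (p : measurableTypeR R * 'rV[R]_n) (h : R) j :
  h *: delta_mx ord0 (lift ord0 j) + rV_cons p =
  rV_cons (p.1, h *: delta_mx ord0 j + p.2).
Proof.
apply/rowP => i; rewrite mxE; case: (unliftP ord0 i) => [k ->|->].
  by rewrite !rV_cons_lift !mxE (inj_eq lift_inj).
by rewrite !rV_cons0 !mxE mulr0 add0r.
Qed.

Lemma rV_cons_continuous1 n (x : 'rV[R]_n) :
  continuous (fun a : R => rV_cons (a : measurableTypeR R, x)).
Proof.
apply: continuous_rV => i; case: (unliftP ord0 i) => [j|] ->.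
  rewrite (_ : (fun a => _) = cst (x ord0 j)); first exact: cst_continuous.
  by apply/funext => y; rewrite rV_cons_lift.
rewrite (_ : (fun a => _) = id); first by move=> a; exact: cvg_id.
by apply/funext => y; rewrite rV_cons0.
Qed.

Lemma rV_cons_continuous2 n (a : measurableTypeR R) :
  continuous (fun x : 'rV[R]_n => rV_cons (a, x)).
Proof.
apply: continuous_rV => i; case: (unliftP ord0 i) => [j|] ->.
  rewrite (_ : (fun y => _) = (fun y : 'rV[R]_n => y ord0 j)).
    exact: coor_continuous.
  by apply/funext => y; rewrite rV_cons_lift.
rewrite (_ : (fun y => _) = cst a); first exact: cst_continuous.
by apply/funext => y; rewrite rV_cons0.
Qed.

Lemma integral_derive_cube_support (f : R -> R) (M : R) :
  (forall x, derivable f x 1) -> continuous f^`()%classic ->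
  (forall x, M <= `|x| -> f x = 0) ->
  (\int[@lebesgue_measure R]_x (f^`()%classic x)%:E)%E = 0%E.
Proof.
move=> df cf f0.
(* Strictly beyond [M], so that [f] vanishes at both ends and near every point with [|x| > N];
   positive, so that the interval is nondegenerate. *)
pose N : R := Num.max M 0 + 1.
have NM : M < N /\ 0 < N.
  by rewrite /N; split; [rewrite ltr_pwDr// le_max lexx|rewrite ltr_pwDr// le_max lexx orbT].
have f'0 x : N < `|x| -> f^`()%classic x = 0.
  move=> Nx; rewrite derive1E.
  have [_ //] : is_derive x (1 : R) f 0.
  apply: (@near_eq_is_derive _ _ _ (cst 0)).
  near=> y; rewrite f0//; apply: (le_trans (ltW NM.1)).
  by near: y; apply: (cvgr_ge `|x|) => //; exact: norm_continuous.
have cfx : continuous f by move=> x; apply/differentiable_continuous/derivable1_diffP.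
transitivity (\int[@lebesgue_measure R]_(x in `[(- N)%R, N]) (f^`()%classic x)%:E)%E.
  rewrite [RHS]integral_mkcond; apply: eq_integral => x _; rewrite patchE.
  case: ifPn => // xN; rewrite f'0// ltNge; apply: contra xN.
  by rewrite inE/= in_itv/= ler_norml.
rewrite (@continuous_FTC2 _ _ f); last 4 first.
- by rewrite gtrN//; exact: NM.2.
- exact: continuous_subspaceT.
- split; first by move=> x _; exact: df.
  + by apply: cvg_at_right_filter; exact: cfx.
  + by apply: cvg_at_left_filter; exact: cfx.
- by [].
by case: NM => MN N0; rewrite !f0 ?subee// ?normrN gtr0_norm// ltW.
Unshelve. all: by end_near. Qed.

(** Induction on the dimension by Fubini. For the first coordinate the inner integral is over the
    [R] factor and vanishes by the fundamental theorem of calculus; for any other it is over ['rV_n]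
    and vanishes by the induction hypothesis. *)
Lemma integral_partial0 n (i : 'I_n) (f : 'rV[R]_n -> R) M :
  (forall x, derivable f x (delta_mx ord0 i)) -> continuous (partial i f) ->
  (forall x, ~ cube M x -> f x = 0) ->
  (\int[lebesgue_rV R n]_x (partial i f x)%:E)%E = 0%E.
Proof.
elim: n i f => [[]//|n ih] i f df cf f0.
have p0 x : ~ cube (M + 1) x -> partial i f x = 0.
  by move=> /(notin_cube_near0 f0) /(partial_locally0 i); exact: partialE.
have [K fK] := cube_support_bounded cf p0.
have mp : measurable_fun setT (partial i f) by exact: continuous_measurable_rV.
have intp : ((@lebesgue_measure R) \x lebesgue_rV R n)%E.-integrable setT
    (EFin \o (partial i f \o @rV_cons R n)).
  apply: (@bounded_support_integrable _ _ _ _ (@rV_cons R n @^-1` cube (M + 1)) _ K) => //.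
  - rewrite -[X in measurable X]setTI; apply: measurable_rV_cons => //.
    exact: measurable_cube.
  - have [M0|M0] := leP 0 (M + 1).
      apply: (@le_lt_trans _ _ (lebesgue_rV R n.+1 (cube (M + 1)))) => //.
      by rewrite lebesgue_rV_cube// ltry.
    rewrite (_ : cube _ = set0) ?preimage_set0 ?measure0//.
    apply/seteqP; split => // x /(_ ord0) /(le_lt_trans (normr_ge0 _)) /lt_trans.
    by move=> /(_ _ M0); rewrite ltxx.
  - by apply: measurableT_comp => //; exact: measurable_rV_cons.
  - by move=> x; exact: fK.
  - by move=> x xM; exact: p0.
transitivity (\int[pushforward ((@lebesgue_measure R) \x lebesgue_rV R n)%E (@rV_cons R n)]_x
   (partial i f x)%:E)%E; first by [].
rewrite integral_pushforward//; last first.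
- by apply/measurable_EFinP.
- exact: measurable_rV_cons.
rewrite preimage_setT.
case: (unliftP ord0 i) => [j ij|ij]; subst i.
- rewrite -integral12_prod_meas1// integral0_eq// => a _.
  rewrite /fubini_F/=.
  pose g x := f (rV_cons (a, x)).
  have dg x : is_derive x (delta_mx ord0 j) g
     (partial (lift ord0 j) f (rV_cons (a, x))).
    apply/is_derive_line; rewrite /g.
    rewrite (_ : (fun h => _) = (fun h => f (h *: delta_mx ord0 (lift ord0 j) + rV_cons (a, x)))).
      by apply: (is_derive_line f _ _ _).1; apply: derivableP; exact: df.
    by apply/funext => h; rewrite rV_cons_shift_lift.
  rewrite -(ih j g).
  + by apply: eq_integral => x _; rewrite (partialE (dg x)).
  + by move=> x; have [] := dg x.
  + rewrite (_ : partial j g = fun x => partial (lift ord0 j) f (rV_cons (a, x))).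
      move=> x; apply: continuous_comp; first exact: rV_cons_continuous2.
      exact: cf.
    by apply/funext => x; exact: partialE.
  + move=> x xM; apply: f0 => h; apply: xM => k.
    by have := h (lift ord0 k); rewrite rV_cons_lift.
- rewrite -integral21_prod_meas1// integral0_eq// => x _.
  rewrite /fubini_G/=.
  pose g (a : R) := f (rV_cons (a : measurableTypeR R, x)).
  have dg a : is_derive a (1 : R) g (partial ord0 f (rV_cons (a : measurableTypeR R, x))).
    apply/is_derive_line; rewrite /g.
    rewrite (_ : (fun h => _) = 
        (fun h => f (h *: delta_mx ord0 ord0 + rV_cons (a : measurableTypeR R, x)))).
      by apply: (is_derive_line f _ _ _).1; apply: derivableP; exact: df.
    by apply/funext => h; rewrite rV_cons_shift0/= [h *: _]mulr1.
  rewrite -(@integral_derive_cube_support g M).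
  + by apply: eq_integral => a _; rewrite derive1E; have [_ ->] := dg a.
  + by move=> a; have [] := dg a.
  + rewrite (_ : g^`()%classic = fun a => partial ord0 f (rV_cons (a : measurableTypeR R, x))).
      move=> a; apply: continuous_comp; first exact: rV_cons_continuous1.
      exact: cf.
    by apply/funext => a; rewrite derive1E; have [_ ->] := dg a.
  + move=> a aM; apply: f0 => /(_ ord0); rewrite rV_cons0/= => /lt_le_trans.
    by move=> /(_ _ aM); rewrite ltxx.
Qed.

End int_partial.

(** * Integration by parts against test functions *)

Section Cc_infty_lemmas.
Context {R : realType} {n : nat}.
Implicit Types (D : set 'rV[R]_n) (phi : 'rV[R]_n -> R).
Local Notation mu := (lebesgue_rV R n).

Lemma Cc_infty_continuous D phi : Cc_infty D phi -> continuous phi.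
Proof. by move=> [/(_ [::])[]]. Qed.

Lemma Cc_infty_is_derive D phi i x : Cc_infty D phi ->
  is_derive x (delta_mx ord0 i) phi (partial i phi x).
Proof. by move=> [/(_ [::])[_ d] _ _]; apply: derivableP; exact: d. Qed.

Lemma Cc_infty_continuous_partial D phi i :
  Cc_infty D phi -> continuous (partial i phi).
Proof. by move=> [/(_ [:: i])[]]. Qed.

Lemma Cc_infty_near0 D phi x : Cc_infty D phi -> ~ D x ->
  \forall y \near x, phi y = 0.
Proof.
move=> [_ _ sD] Dx.
have : nbhs x (~` closure [set x | phi x != 0]).
  apply: open_nbhs_nbhs; split; last by move=> /sD.
  by rewrite openC; exact: closed_closure.
apply: filterS => y yc.
by apply: contrapT => /eqP y0; apply: yc; exact: subset_closure.
Qed.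

Lemma Cc_infty_out D phi x : Cc_infty D phi -> ~ D x -> phi x = 0.
Proof. by move=> h /(Cc_infty_near0 h)/nbhs_singleton. Qed.

Lemma Cc_infty_partial_out D phi i x :
  Cc_infty D phi -> ~ D x -> partial i phi x = 0.
Proof. by move=> h /(Cc_infty_near0 h)/(partial_locally0 i)/partialE. Qed.

Lemma Cc_infty_bounded D phi M : D `<=` cube M -> Cc_infty D phi ->
  exists K, forall x, `|phi x| <= K.
Proof.
move=> DM h; apply: (@cube_support_bounded _ _ _ M).
  exact: Cc_infty_continuous h.
by move=> x xM; apply: (Cc_infty_out h) => /DM.
Qed.

Lemma Cc_infty_partial_bounded D phi i M : D `<=` cube M -> Cc_infty D phi ->
  exists K, forall x, `|partial i phi x| <= K.
Proof.
move=> DM h; apply: (@cube_support_bounded _ _ _ M).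
  exact: Cc_infty_continuous_partial h.
by move=> x xM; apply: (Cc_infty_partial_out _ h) => /DM.
Qed.

(** [G] is the derivative of [phi * w] on the whole space: on [D] by the product rule, and off [D]
    because [phi] vanishes near each such point, whatever [w] is there. Its integral is thus 0. *)
Lemma integration_by_parts_Cc D phi i (w dw : 'rV[R]_n -> R) (M : R) :
  D `<=` cube M -> Cc_infty D phi ->
  (forall x, D x -> is_derive x (delta_mx ord0 i) w (dw x)) ->
  (forall x, D x -> {for x, continuous w}) ->
  (forall x, D x -> {for x, continuous dw}) ->
  let G := fun x => w x * partial i phi x + dw x * phi x in
  continuous G /\ (\int[mu]_(x in D) (G x)%:E = 0)%E.
Proof.
move=> DM h ww cw cdw G.
have dG x : is_derive x (delta_mx ord0 i) (phi * w) (G x).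
  have [Dx|Dx] := pselect (D x).
    apply: (is_derive_eq (is_deriveM (Cc_infty_is_derive i x h) (ww _ Dx))).
    by rewrite /G/= /GRing.scale/= addrC (mulrC (phi x)).
  rewrite /G (Cc_infty_out h)// (Cc_infty_partial_out _ h)// !mulr0 addr0.
  apply: partial_locally0; apply: filterS (Cc_infty_near0 h Dx) => y y0.
  by rewrite /GRing.mul/= y0 mul0r.
have cG : continuous G.
  move=> x; have [Dx|Dx] := pselect (D x).
    apply: (@continuousD R R 'rV[R]_n (fun y => w y * partial i phi y)
      (fun y => dw y * phi y)); apply: continuousM.
    - exact: cw.
    - exact: Cc_infty_continuous_partial h _.
    - exact: cdw.
    - exact: Cc_infty_continuous h _.
  have G0 : \forall y \near x, 0 = G y.
    apply: filterS (nbhs_interior (Cc_infty_near0 h Dx)) => y n0.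
    rewrite /G (nbhs_singleton n0) (partialE (partial_locally0 i n0)).
    by rewrite !mulr0 addr0.
  have : G y @[y --> x] --> (0 : R).
    by apply: cvg_trans (near_eq_cvg G0) _; exact: cvg_cst.
  by rewrite (nbhs_singleton G0).
split=> //.
have E : partial i (phi * w) = G by apply/funext => x; exact: partialE.
rewrite -[RHS](@integral_partial0 R n i (phi * w) M).
- rewrite integral_mkcond; apply: eq_integral => x _; rewrite patchE E.
  case: ifPn => // /negP xD; rewrite /G.
  rewrite (Cc_infty_out h) ?(Cc_infty_partial_out _ h) ?mulr0 ?addr0//.
    by move=> Dx; apply: xD; rewrite inE.
  by move=> Dx; apply: xD; rewrite inE.
- by move=> x; have [] := dG x.
- by rewrite E.
- by move=> x xM; rewrite /GRing.mul/= (Cc_infty_out h) ?mul0r// => /DM.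
Qed.

End Cc_infty_lemmas.

Lemma cvg_div_natSS (R : realType) (a : R) :
  a / k.+2%:R @[k --> \oo] --> (0 : R).
Proof.
rewrite -[X in _ --> X](mulr0 a); apply: cvgMl_tmp.
by have := @cvg_harmonic R; rewrite -cvg_shiftS.
Qed.

(** * Passing to the limit across the origin *)

Section singular.
Context {R : realType} {n : nat} (n3 : (3 <= n)%N).
Local Notation mu := (lebesgue_rV R n).
Variable (r : R).
Hypothesis r1 : r <= 1.
Local Notation D := (eball r : set 'rV[R]_n).

Let n0 : (0 < n)%N. Proof. exact: leq_trans n3. Qed.

Lemma integrable_inv_sqr_enorm_eball C :
  mu.-integrable D (fun x => (C * (enorm x ^+ 2)^-1)%:E).
Proof.
rewrite (_ : (fun x => _) = fun x => (C%:E * (enorm x ^+ 2)^-1%:E)%E) //.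
apply: integrableZl; first exact: measurable_eball.
apply: (@integrableS _ _ _ _ (eball 1)); [exact: measurable_eball..| |].
  by move=> x /= xr; exact: lt_le_trans xr r1.
exact: integrable_inv_sqr_enorm.
Qed.

(** Dominated convergence with the majorant [C |x|^-2]. Convergence and bound are asked only for
    [x != 0], so the values of the total functions at the singularity do not matter. *)
Lemma singular_dominated (f_ : nat -> 'rV[R]_n -> R) (f : 'rV[R]_n -> R) C :
  (forall k, measurable_fun D (f_ k)) -> measurable_fun D f ->
  (forall x, D x -> x != 0 -> f_ k x @[k --> \oo] --> f x) ->
  (forall k x, D x -> x != 0 -> `|f_ k x| <= C * (enorm x ^+ 2)^-1) ->
  mu.-integrable D (EFin \o f) /\
  (\int[mu]_(x in D) (f_ k x)%:E @[k --> \oo] --> \int[mu]_(x in D) (f x)%:E)%E.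
Proof.
move=> mf_ mf cf df.
have [] := @dominated_convergence _ _ _ mu D (measurable_eball r)
  (fun k => EFin \o f_ k) (EFin \o f) (fun x => (C * (enorm x ^+ 2)^-1)%:E).
- by move=> k; exact/measurable_EFinP.
- exact/measurable_EFinP.
- apply: filterS (ae_neq0 n0) => x x0 Dx.
  by apply: cvg_EFin; [exact: nearW|exact: cf].
- exact: integrable_inv_sqr_enorm_eball.
- by apply: filterS (ae_neq0 n0) => x x0 k Dx; rewrite lee_fin df.
- by move=> ? _ ?; split.
Qed.

Lemma singular_integrable (f : 'rV[R]_n -> R) C : measurable_fun D f ->
  (forall x, D x -> x != 0 -> `|f x| <= C * (enorm x ^+ 2)^-1) ->
  mu.-integrable D (EFin \o f).
Proof.
move=> mf fC; have [] // := @singular_dominated (fun=> f) f C => //.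
by move=> x _ _; exact: cvg_cst.
Qed.

(* [W eta] regularizes [W 0], whose only singularity is the origin; the bound by
   [|x|^-2], integrable as [n >= 3], lets [eta] tend to 0. *)
Lemma singular_integration_by_parts (W dW : R -> 'rV[R]_n -> R) (a C : R) phi i :
  0 < a -> Cc_infty D phi ->
  (forall eta x, 0 < eta < a -> D x ->
    is_derive x (delta_mx ord0 i) (W eta) (dW eta x)) ->
  (forall eta x, 0 < eta < a -> D x -> {for x, continuous (W eta)}) ->
  (forall eta x, 0 < eta < a -> D x -> {for x, continuous (dW eta)}) ->
  (forall eta x, 0 <= eta < a -> D x -> x != 0 ->
    `|W eta x| <= C * (enorm x ^+ 2)^-1 /\ `|dW eta x| <= C * (enorm x ^+ 2)^-1) ->
  (forall x, D x -> x != 0 -> W eta x @[eta --> (0:R)] --> W 0 x) ->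
  (forall x, D x -> x != 0 -> dW eta x @[eta --> (0:R)] --> dW 0 x) ->
  measurable_fun D (W 0) -> measurable_fun D (dW 0) ->
  [/\ mu.-integrable D (EFin \o (fun x => W 0 x * partial i phi x)),
      mu.-integrable D (EFin \o (fun x => dW 0 x * phi x)) &
      \int[mu]_(x in D) (W 0 x * partial i phi x) =
      - \int[mu]_(x in D) (dW 0 x * phi x)].
Proof.
move=> a0 h dWW cW cdW bd cvW cvdW mW mdW.
have [K1 K1b] := Cc_infty_bounded (@eball_sub_cube _ _ r) h.
have [K2 K2b] := Cc_infty_partial_bounded i (@eball_sub_cube _ _ r) h.
have mphi : measurable_fun D phi.
  by apply: measurable_funTS; apply: continuous_measurable_rV; exact: Cc_infty_continuous h.
have mpphi : measurable_fun D (partial i phi).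
  by apply: measurable_funTS; apply: continuous_measurable_rV; exact: Cc_infty_continuous_partial h.
have bd1 eta x : 0 <= eta < a -> D x -> x != 0 ->
    `|W eta x * partial i phi x| <= C * K2 * (enorm x ^+ 2)^-1.
  move=> ea Dx x0; have [b1 _] := bd _ _ ea Dx x0.
  by rewrite normrM mulrAC; apply: ler_pM.
have bd2 eta x : 0 <= eta < a -> D x -> x != 0 ->
    `|dW eta x * phi x| <= C * K1 * (enorm x ^+ 2)^-1.
  move=> ea Dx x0; have [_ b1] := bd _ _ ea Dx x0.
  by rewrite normrM mulrAC; apply: ler_pM.
have a00 : 0 <= (0:R) < a by rewrite lexx.
have i1 : mu.-integrable D (EFin \o (fun x => W 0 x * partial i phi x)).
  apply: (@singular_integrable _ (C * K2)); first exact: measurable_funM.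
  by move=> x; exact: bd1.
have i2 : mu.-integrable D (EFin \o (fun x => dW 0 x * phi x)).
  apply: (@singular_integrable _ (C * K1)); first exact: measurable_funM.
  by move=> x; exact: bd2.
split=> //.
(* Dividing by [k+2 > 1] keeps every term strictly between 0 and [a]. *)
pose e (k : nat) : R := a / k.+2%:R.
have e0 k : 0 < e k < a.
  by rewrite divr_gt0//= ltr_pdivrMr// ltr_pMr// ltr1n.
have ecv : e k @[k --> \oo] --> (0:R).
  exact: cvg_div_natSS.
have [] := @singular_dominated
  (fun k x => W (e k) x * partial i phi x + dW (e k) x * phi x)
  (fun x => W 0 x * partial i phi x + dW 0 x * phi x) (C * K2 + C * K1).
- move=> k; apply: measurable_funTS; apply: continuous_measurable_rV.
  by have [] := @integration_by_parts_Cc R n D phi i (W (e k)) (dW (e k)) r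
    (@eball_sub_cube _ _ r) h (fun x => dWW (e k) x (e0 k)) (fun x => cW (e k) x (e0 k))
    (fun x => cdW (e k) x (e0 k)).
- by apply: measurable_funD; exact: measurable_funM.
- move=> x Dx x0; apply: cvgD; apply: cvgMr_tmp.
  + exact: (cvg_comp _ _ ecv (cvW x Dx x0)).
  + exact: (cvg_comp _ _ ecv (cvdW x Dx x0)).
- move=> k x Dx x0; apply: le_trans (ler_normD _ _) _; rewrite mulrDl.
  have ek : 0 <= e k < a by case/andP: (e0 k) => /ltW -> ->.
  by apply: lerD; [exact: bd1|exact: bd2].
have E k : (\int[mu]_(x in D) (W (e k) x * partial i phi x + dW (e k) x * phi x)%:E = 0)%E.
  by have [] := @integration_by_parts_Cc R n D phi i (W (e k)) (dW (e k)) r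
    (@eball_sub_cube _ _ r) h (fun x => dWW (e k) x (e0 k)) (fun x => cW (e k) x (e0 k))
    (fun x => cdW (e k) x (e0 k)).
(* The regularized integrals are all 0, hence so is their limit. *)
move=> _; under eq_fun do rewrite E.
move=> /(@cvg_unique _ (@ereal_hausdorff R)) /(_ (cvg_cst _)) I0.
apply/eqP; rewrite -addr_eq0 -RintegralD//; last exact: measurable_eball.
by rewrite /Rintegral I0.
Qed.

End singular.

(** * Radial functions *)

Lemma is_derive_mul (R : numFieldType) (V : normedModType R) (f g : V -> R)
    (x v : V) (df dg : R) :
  is_derive x v f df -> is_derive x v g dg ->
  is_derive x v (fun y => f y * g y) (f x * dg + df * g x).
Proof.
move=> hf hg; apply: (is_derive_eq (is_deriveM hf hg)).
by rewrite /GRing.scale/= (mulrC (g x)).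
Qed.

Lemma is_derive_opp (R : numFieldType) (V : normedModType R) (f : V -> R)
    (x v : V) (df : R) :
  is_derive x v f df -> is_derive x v (fun y => - f y) (- df).
Proof. exact: is_deriveN. Qed.

Section directional.
Context {R : realType} {n : nat}.
Implicit Types (x v : 'rV[R]_n) (f g : 'rV[R]_n -> R).

Lemma is_derive_coor x v j :
  is_derive x v (fun y : 'rV[R]_n => y ord0 j) (v ord0 j).
Proof.
apply: (is_derive_line _ _ _ _).2.
rewrite (_ : (fun h : R => _) = (fun h : R => h * v ord0 j + x ord0 j)); last first.
  by apply/funext => h; rewrite !mxE.
apply: is_derive_eq.
by rewrite !scaler0 /GRing.scale/= mulr1 add0r addr0.
Qed.

Lemma is_derive_dotrv x i :
  is_derive x (delta_mx ord0 i) (fun y : 'rV[R]_n => dotrv y y) (2 * x ord0 i).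
Proof.
pose h j (y : 'rV[R]_n) := y ord0 j.
rewrite (_ : (fun y => _) = \sum_(j < n) (h j * h j)); last first.
  by apply/funext => y; rewrite fct_sumE.
apply: (is_derive_eq (is_derive_sum (fun j =>
  is_deriveM (is_derive_coor x (delta_mx ord0 i) j) (is_derive_coor x _ j)))).
rewrite (bigD1 i)//= big1 => [|j ji].
  by rewrite !mxE !eqxx /GRing.scale/= mulr1 addr0 mulr_natl mulr2n.
by rewrite !mxE (negbTE ji) andbF !scaler0 addr0.
Qed.

Lemma is_derive_comp1 (F : R -> R) (g : 'rV[R]_n -> R) x v (dF dg : R) :
  is_derive (g x) 1 F dF -> is_derive x v g dg ->
  is_derive x v (fun y => F (g y)) (dF * dg).
Proof.
move=> hF /(is_derive_line g x v dg).1 hg.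
apply: (is_derive_line (fun y => F (g y)) x v _).2.
apply: (@is_derive1_comp R F (fun h : R => g (h *: v + x))) => //.
by rewrite scale0r add0r.
Qed.

Lemma is_derive_shift_dotrv (eta : R) x i :
  is_derive x (delta_mx ord0 i) (fun y : 'rV[R]_n => dotrv y y + eta) (2 * x ord0 i).
Proof.
apply: (is_derive_eq (is_deriveD (is_derive_dotrv x i) (is_derive_cst eta x _))).
by rewrite addr0.
Qed.

Lemma shift_dotrv_continuous (eta : R) :
  continuous (fun y : 'rV[R]_n => dotrv y y + eta).
Proof.
move=> y; apply: (@continuousD R R 'rV[R]_n (fun y => dotrv y y) (cst eta)).
  exact: dotrvv_continuous.
exact: cst_continuous.
Qed.

End directional.

Section radial.
Context {R : realType} {n : nat} (n3 : (3 <= n)%N).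
Local Notation mu := (lebesgue_rV R n).
Variables (r S : R).
Hypotheses (r1 : r <= 1) (rS : r ^+ 2 < S).
Local Notation D := (eball r : set 'rV[R]_n).
Variables (F F' : R -> R) (C : R).
Hypothesis C0 : 0 <= C.
Hypothesis dF : forall s, 0 < s < S -> is_derive s 1 F (F' s).
Hypothesis cF' : forall s, 0 < s < S -> {for s, continuous F'}.
Hypothesis FC : forall s, 0 < s < S -> `|F s| <= C / s.
Hypothesis mF : measurable_fun setT F.
Hypothesis mF' : measurable_fun setT F'.

(** The room for the shift: [|x|^2 + eta] stays in []0, S[] when [|x| < r] and [0 < eta < a]. *)
Let a := S - r ^+ 2.

Let a0 : 0 < a. Proof. by rewrite subr_gt0. Qed.

Let sS eta (x : 'rV[R]_n) : 0 < eta < a -> D x -> 0 < dotrv x x + eta < S.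
Proof.
move=> /andP[e0 ea] Dx; rewrite ltr_wpDl ?dotrv_ge0//=.
have : dotrv x x < r ^+ 2 by rewrite -sqr_enorm ltrXn2r// enorm_ge0.
by move: ea; rewrite /a; lra.
Qed.

Let sS0 eta (x : 'rV[R]_n) : 0 <= eta < a -> D x -> x != 0 ->
  0 < dotrv x x + eta < S.
Proof.
move=> /andP[e0 ea] Dx x0.
have q0 : 0 < dotrv x x by rewrite -sqr_enorm exprn_gt0// enorm_gt0.
rewrite ltr_wpDr//=.
have : dotrv x x < r ^+ 2 by rewrite -sqr_enorm ltrXn2r// enorm_ge0.
by move: ea; rewrite /a; lra.
Qed.

Let cF s : 0 < s < S -> {for s, continuous F}.
Proof.
by move=> /dF[d _]; apply/differentiable_continuous/derivable1_diffP.
Qed.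

Let mdot : measurable_fun D (fun x : 'rV[R]_n => dotrv x x + 0).
Proof.
apply: measurable_funTS; apply: continuous_measurable_rV.
exact: shift_dotrv_continuous.
Qed.

Let mcoor i : measurable_fun D (fun x : 'rV[R]_n => x ord0 i).
Proof. by apply: measurable_funTS; exact: measurable_coor. Qed.

Let inv_le eta (x : 'rV[R]_n) : 0 <= eta -> x != 0 ->
  (dotrv x x + eta)^-1 <= (enorm x ^+ 2)^-1.
Proof.
move=> e0 x0.
have q0 : 0 < dotrv x x by rewrite -sqr_enorm exprn_gt0// enorm_gt0.
by rewrite sqr_enorm lef_pV2 ?posrE ?ltr_wpDr// lerDl.
Qed.

Let cvg_shift (G : R -> R) (x : 'rV[R]_n) : {for dotrv x x, continuous G} ->
  G (dotrv x x + eta) @[eta --> (0:R)] --> G (dotrv x x + 0).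
Proof.
move=> cG; apply: (@continuous_comp _ _ _ (fun eta => dotrv x x + eta) G).
  by apply: cvgD; [exact: cvg_cst|exact: cvg_id].
by rewrite addr0.
Qed.

(** Yields the weak gradient of [F(|x|^2)]. As [|x_i| <= 1], the bound [C / s] on [F'] suffices; the
    constant [2 C] comes from the derivative [2 x_i] of [|x|^2]. *)
Lemma radial_integration_by_parts phi i : Cc_infty D phi ->
  (forall s, 0 < s < S -> `|F' s| <= C / s) ->
  let w := fun x : 'rV[R]_n => F (dotrv x x) in
  let dw := fun x : 'rV[R]_n => F' (dotrv x x) * (2 * x ord0 i) in
  [/\ mu.-integrable D (EFin \o (fun x => w x * partial i phi x)),
      mu.-integrable D (EFin \o (fun x => dw x * phi x)) &
      \int[mu]_(x in D) (w x * partial i phi x) =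
      - \int[mu]_(x in D) (dw x * phi x)].
Proof.
move=> h FC' w dw.
have -> : w = (fun x => F (dotrv x x + 0)) by apply/funext => x; rewrite addr0.
have -> : dw = (fun x => F' (dotrv x x + 0) * (2 * x ord0 i)).
  by apply/funext => x; rewrite addr0.
apply: (@singular_integration_by_parts R n n3 r r1
  (fun eta (x : 'rV[R]_n) => F (dotrv x x + eta))
  (fun eta (x : 'rV[R]_n) => F' (dotrv x x + eta) * (2 * x ord0 i)) a (C * 2)) => //.
- move=> eta x ea Dx; apply: is_derive_comp1; first exact: dF (sS ea Dx).
  exact: is_derive_shift_dotrv.
- move=> eta x ea Dx.
  apply: (@continuous_comp _ _ _ (fun x => dotrv x x + eta) F).
    exact: shift_dotrv_continuous.
  exact: cF (sS ea Dx).
- move=> eta x ea Dx; apply: continuousM.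
    apply: (@continuous_comp _ _ _ (fun x => dotrv x x + eta) F').
      exact: shift_dotrv_continuous.
    exact: cF' (sS ea Dx).
  apply: (@continuousM R 'rV[R]_n (cst 2) (fun x => x ord0 i)).
    exact: cst_continuous.
  exact: coor_continuous.
- move=> eta x ea Dx x0; have sx := sS0 ea Dx x0; have /andP[e0 _] := ea.
  have := inv_le e0 x0 => il; split.
    apply: le_trans (FC sx) _; rewrite -mulrA; apply: ler_wpM2l => //.
    apply: le_trans il _; rewrite ler_peMl ?invr_ge0 ?sqr_ge0// ler1n//.
  rewrite !normrM [`|2|]ger0_norm// (mulrAC C); apply: ler_pM => //.
    by apply: le_trans (FC' _ sx) _; apply: ler_wpM2l.
  rewrite ler_piMr//; apply: le_trans (coor_le_enorm _ _) _.
  exact: le_trans (ltW Dx) r1.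
- move=> x Dx x0; apply: cvg_shift; apply: cF.
  by have := sS0 (_ : 0 <= 0 < a) Dx x0; rewrite addr0; apply; rewrite lexx.
- move=> x Dx x0; apply: cvgMr_tmp; apply: cvg_shift; apply: cF'.
  by have := sS0 (_ : 0 <= 0 < a) Dx x0; rewrite addr0; apply; rewrite lexx.
- exact: measurableT_comp.
- apply: measurable_funM; first exact: measurableT_comp.
  exact: measurable_funM.
Qed.

(** Yields the divergence of the field [F(|x|^2) x]. Here [F'] may be as large as [C / s^2], since
    it is multiplied by [2 x_i^2 <= 2 s]; together with the term [F] this gives the constant
    [3 C]. *)
Lemma radial_coor_integration_by_parts phi i : Cc_infty D phi ->
  (forall s, 0 < s < S -> `|F' s| <= C / s ^+ 2) ->
  let w := fun x : 'rV[R]_n => x ord0 i * F (dotrv x x) in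
  let dw := fun x : 'rV[R]_n => x ord0 i * (F' (dotrv x x) * (2 * x ord0 i)) + F (dotrv x x) in
  [/\ mu.-integrable D (EFin \o (fun x => w x * partial i phi x)),
      mu.-integrable D (EFin \o (fun x => dw x * phi x)) &
      \int[mu]_(x in D) (w x * partial i phi x) =
      - \int[mu]_(x in D) (dw x * phi x)].
Proof.
move=> h FC' w dw.
have -> : w = (fun x => x ord0 i * F (dotrv x x + 0)) by apply/funext => x; rewrite addr0.
have -> : dw = (fun x => x ord0 i * (F' (dotrv x x + 0) * (2 * x ord0 i)) + F (dotrv x x + 0)).
  by apply/funext => x; rewrite addr0.
apply: (@singular_integration_by_parts R n n3 r r1
  (fun eta (x : 'rV[R]_n) => x ord0 i * F (dotrv x x + eta))
  (fun eta (x : 'rV[R]_n) =>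
    x ord0 i * (F' (dotrv x x + eta) * (2 * x ord0 i)) + F (dotrv x x + eta))
   a (C * 3)) => //.
- move=> eta x ea Dx.
  apply: is_derive_eq.
    apply: is_derive_mul; first exact: is_derive_coor.
    apply: is_derive_comp1; first exact: dF (sS ea Dx).
    exact: is_derive_shift_dotrv.
  by rewrite mxE !eqxx mul1r.
- move=> eta x ea Dx; apply: continuousM; first exact: coor_continuous.
  apply: (@continuous_comp _ _ _ (fun x => dotrv x x + eta) F).
    exact: shift_dotrv_continuous.
  exact: cF (sS ea Dx).
- move=> eta x ea Dx.
  apply: (@continuousD R R 'rV[R]_n
    (fun x => x ord0 i * (F' (dotrv x x + eta) * (2 * x ord0 i)))
    (fun x => F (dotrv x x + eta))); last first.
    apply: (@continuous_comp _ _ _ (fun x => dotrv x x + eta) F).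
      exact: shift_dotrv_continuous.
    exact: cF (sS ea Dx).
  apply: continuousM; first exact: coor_continuous.
  apply: continuousM.
    apply: (@continuous_comp _ _ _ (fun x => dotrv x x + eta) F').
      exact: shift_dotrv_continuous.
    exact: cF' (sS ea Dx).
  apply: (@continuousM R 'rV[R]_n (cst 2) (fun x => x ord0 i)).
    exact: cst_continuous.
  exact: coor_continuous.
- move=> eta x ea Dx x0; have sx := sS0 ea Dx x0; have /andP[e0 _] := ea.
  have il := inv_le e0 x0.
  have xi1 : `|x ord0 i| <= 1.
    apply: le_trans (coor_le_enorm _ _) _; exact: le_trans (ltW Dx) r1.
  have i0 : 0 <= (enorm x ^+ 2)^-1 by rewrite invr_ge0 sqr_ge0.
  have F1 : `|F (dotrv x x + eta)| <= C * (enorm x ^+ 2)^-1.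
    by apply: le_trans (FC sx) _; apply: ler_wpM2l.
  have CE : C * (enorm x ^+ 2)^-1 <= C * 3 * (enorm x ^+ 2)^-1.
    rewrite -mulrA; apply: ler_wpM2l => //; rewrite ler_peMl// ler1n//.
  split.
    rewrite normrM; apply: le_trans CE; apply: le_trans F1.
    by rewrite ler_piMl.
  apply: le_trans (ler_normD _ _) _.
  rewrite [leRHS](_ : _ = C * (enorm x ^+ 2)^-1 * 2 + C * (enorm x ^+ 2)^-1); last by ring.
  apply: lerD => //.
  rewrite mulrCA normrM (mulrCA _ 2) -expr2 normrM [`|2|]ger0_norm//.
  rewrite [`|_ ^+ 2|]ger0_norm ?sqr_ge0//.
  rewrite (mulrC 2) mulrA ler_wpM2r//.
  set s := dotrv x x + eta in sx il F1 *.
  have xs : x ord0 i ^+ 2 <= s.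
    rewrite /s -[x ord0 i ^+ 2]addr0; apply: lerD => //.
    rewrite -sqr_enorm -[leLHS]real_normK ?num_real// lerXn2r ?nnegrE ?enorm_ge0//.
    exact: coor_le_enorm.
  have s0 : 0 < s by case/andP: sx.
  apply: (@le_trans _ _ (C / s ^+ 2 * s)).
    by apply: ler_pM => //; [exact: sqr_ge0|exact: FC'].
  by rewrite expr2 invfM mulrA divfK ?gt_eqF//; apply: ler_wpM2l.
- move=> x Dx x0; apply: cvgMl_tmp; apply: cvg_shift; apply: cF.
  by have := sS0 (_ : 0 <= 0 < a) Dx x0; rewrite addr0; apply; rewrite lexx.
- have sx (x : 'rV[R]_n) : D x -> x != 0 -> 0 < dotrv x x < S.
    move=> Dx x0.
    by have := sS0 (_ : 0 <= 0 < a) Dx x0; rewrite addr0; apply; rewrite lexx.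
  move=> x Dx x0; apply: cvgD; last by apply: cvg_shift; apply: cF; exact: sx.
  apply: cvgMl_tmp; apply: cvgMr_tmp; apply: cvg_shift; apply: cF'; exact: sx.
- by apply: measurable_funM => //; exact: measurableT_comp.
- apply: measurable_funD; last exact: measurableT_comp.
  apply: measurable_funM => //; apply: measurable_funM; first exact: measurableT_comp.
  exact: measurable_funM.
Qed.

End radial.

(** * Weak gradients and weak equations for radial functions *)

Section radial_weak_solution.
Context {R : realType} {n : nat} (n3 : (3 <= n)%N).
Local Notation mu := (lebesgue_rV R n).
Variables (r S : R).
Hypotheses (r1 : r <= 1) (rS : r ^+ 2 < S).
Local Notation D := (eball r : set 'rV[R]_n).
(* Functions of [s = |x|^2]: [F(|x|^2)] has gradient [H(|x|^2) x] with [H = 2 F']. *)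
Variables (F H H' : R -> R) (C : R).
Hypothesis C0 : 0 <= C.
Hypothesis dF : forall s, 0 < s < S -> is_derive s 1 F (H s / 2).
Hypothesis dH : forall s, 0 < s < S -> is_derive s 1 H (H' s).
Hypothesis cH' : forall s, 0 < s < S -> {for s, continuous H'}.
Hypothesis FC : forall s, 0 < s < S -> `|F s| <= C / s.
Hypothesis HC : forall s, 0 < s < S -> `|H s| <= C / s.
Hypothesis H'C : forall s, 0 < s < S -> `|H' s| <= C / s ^+ 2.
Hypothesis mF : measurable_fun setT F.
Hypothesis mH : measurable_fun setT H.
Hypothesis mH' : measurable_fun setT H'.

Definition radial (x : 'rV[R]_n) : R := F (dotrv x x).

Definition radial_grad (x : 'rV[R]_n) : 'rV[R]_n := H (dotrv x x) *: x.

Let mdot : measurable_fun D (fun x : 'rV[R]_n => dotrv x x).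
Proof.
apply: measurable_funTS; apply: continuous_measurable_rV.
exact: dotrvv_continuous.
Qed.

Let mcoor i : measurable_fun D (fun x : 'rV[R]_n => x ord0 i).
Proof. by apply: measurable_funTS; exact: measurable_coor. Qed.

Lemma measurable_radial : measurable_fun D radial.
Proof. exact: measurableT_comp. Qed.

Lemma measurable_radial_grad i : measurable_fun D (fun x => radial_grad x ord0 i).
Proof.
under eq_fun do rewrite mxE.
by apply: measurable_funM => //; exact: measurableT_comp.
Qed.

Let qS (x : 'rV[R]_n) : D x -> x != 0 -> 0 < dotrv x x < S.
Proof.
move=> Dx x0; rewrite -sqr_enorm exprn_gt0 ?enorm_gt0//=.
by apply: lt_trans rS; rewrite ltrXn2r// enorm_ge0.
Qed.

Let xi1 (x : 'rV[R]_n) i : D x -> `|x ord0 i| <= 1.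
Proof.
move=> Dx; apply: le_trans (coor_le_enorm _ _) _; exact: le_trans (ltW Dx) r1.
Qed.

Lemma integrable_radial : mu.-integrable D (EFin \o radial).
Proof.
apply: (singular_integrable n3 r1 (C := C) measurable_radial) => x Dx x0.
by rewrite sqr_enorm; apply: FC; exact: qS.
Qed.

Lemma integrable_radial_grad i :
  mu.-integrable D (EFin \o (fun x => radial_grad x ord0 i)).
Proof.
apply: (singular_integrable n3 r1 (C := C) (measurable_radial_grad i)) => x Dx x0.
rewrite sqr_enorm mxE normrM -[leRHS]mulr1; apply: ler_pM => //; last exact: xi1.
by apply: HC; exact: qS.
Qed.

Lemma radial_gradE (x : 'rV[R]_n) i :
  radial_grad x ord0 i = H (dotrv x x) / 2 * (2 * x ord0 i).
Proof. by rewrite mxE; field. Qed.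

Lemma weak_gradient_radial : weak_gradient D radial radial_grad.
Proof.
split.
- move=> K cK KD; apply: (integrableS (measurable_eball r)) => //.
    exact: measurable_compact_rV.
  exact: integrable_radial.
- move=> i K cK KD; apply: (integrableS (measurable_eball r)) => //.
    exact: measurable_compact_rV.
  exact: integrable_radial_grad.
- move=> phi h i.
  have [] := @radial_integration_by_parts R n n3 r S r1 rS F (fun s => H s / 2)
    C C0 dF _ FC mF _ phi i h.
  + move=> s sS; apply: (@continuousM R R H (cst 2^-1)); last exact: cst_continuous.
    by have [d _] := dH sS; apply/differentiable_continuous/derivable1_diffP.
  + exact: measurable_funM.
  + move=> s sS; apply: le_trans (HC sS).
    by rewrite normrM ler_piMr// ger0_norm ?invr_ge0// invf_le1// ler1n.
  + move=> _ _ ->; congr (- _); apply: eq_Rintegral => x _.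
    by rewrite radial_gradE.
Qed.

(** The bound [C / s] on [F] leaves [F^2] at order [s^-2], so its square has a hypothesis of its
    own. For the gradient, [x_i^2 <= s] gains the missing factor: [(C / s)^2 s = C^2 / s]. *)
Lemma W12_with_radial : (forall s, 0 < s < S -> F s ^+ 2 <= C / s) ->
  W12_with D radial radial_grad.
Proof.
move=> F2; split; last exact: weak_gradient_radial.
- split; first exact: measurable_radial.
  have /integrableP[_] : mu.-integrable D (EFin \o (fun x => radial x ^+ 2)).
    apply: (singular_integrable n3 r1 (C := C)).
      by apply: measurable_funX; exact: measurable_radial.
    move=> x Dx x0; rewrite ger0_norm ?sqr_ge0// sqr_enorm.
    by apply: F2; exact: qS.
  by under eq_integral do rewrite /= ger0_norm ?sqr_ge0//.
- move=> i; split; first exact: measurable_radial_grad.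
  have /integrableP[_] : mu.-integrable D (EFin \o (fun x => radial_grad x ord0 i ^+ 2)).
    apply: (singular_integrable n3 r1 (C := C ^+ 2)).
      by apply: measurable_funX; exact: measurable_radial_grad.
    move=> x Dx x0; rewrite ger0_norm ?sqr_ge0// sqr_enorm mxE exprMn.
    have /andP[q0 qS'] := qS Dx x0.
    have xq : x ord0 i ^+ 2 <= dotrv x x.
      rewrite -sqr_enorm -[leLHS]real_normK ?num_real// lerXn2r ?nnegrE ?enorm_ge0//.
      exact: coor_le_enorm.
    apply: (@le_trans _ _ ((C / dotrv x x) ^+ 2 * dotrv x x)).
      apply: ler_pM => //; [exact: sqr_ge0|exact: sqr_ge0|].
      rewrite -[leLHS]real_normK ?num_real// lerXn2r ?nnegrE ?divr_ge0 ?(ltW q0)//.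
      by apply: HC; exact: qS.
    by rewrite le_eqVlt; apply/orP; left; apply/eqP; field; rewrite gt_eqF.
  by under eq_integral do rewrite /= ger0_norm ?sqr_ge0//.
Qed.

(* The weak form integrates to 0 because [g] is a vector field whose divergence
   [n H + 2 s H'], at [s = |x|^2], is [c . g]. *)
Lemma weak_form_radial (c : 'rV[R]_n -> 'rV[R]_n) phi :
  (forall x, D x -> dotrv (c x) (radial_grad x) =
    n%:R * H (dotrv x x) + 2 * dotrv x x * H' (dotrv x x)) ->
  Cc_infty D phi ->
  mu.-integrable D (EFin \o weak_form c radial_grad phi) /\
  \int[mu]_(x in D) weak_form c radial_grad phi x = 0.
Proof.
move=> cE h.
pose w i (x : 'rV[R]_n) := x ord0 i * H (dotrv x x).
pose dw i (x : 'rV[R]_n) :=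
  x ord0 i * (H' (dotrv x x) * (2 * x ord0 i)) + H (dotrv x x).
have ibp i := @radial_coor_integration_by_parts R n n3 r S r1 rS H H'
    C C0 dH cH' HC mH mH' phi i h H'C.
(* Away from the origin this is the [i]-th derivative of [phi] times the [i]-th component of the
   gradient field; the weak form is the sum of these. *)
pose G i x := w i x * partial i phi x + dw i x * phi x.
have iG i : mu.-integrable D (EFin \o G i).
  have [i1 i2 _] := ibp i.
  exact: (integrableD (measurable_eball r) i1 i2).
have G0 i : (\int[mu]_(x in D) (G i x)%:E = 0)%E.
  have [i1 i2 e] := ibp i.
  have : \int[mu]_(x in D) G i x = 0.
    by rewrite RintegralD//; [rewrite e addNr|exact: measurable_eball].
  rewrite /Rintegral => e0; rewrite -[LHS]fineK ?e0//.
  by apply: integrable_fin_num (iG i); exact: measurable_eball.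
have E x : D x -> weak_form c radial_grad phi x = \sum_(i < n) G i x.
  move=> Dx; rewrite /weak_form cE// big_split/=; congr (_ + _).
    by apply: eq_bigr => i _; rewrite !mxE (mulrC (H _)).
  rewrite -mulr_suml big_split/= sumr_const card_ord mulr_natl addrC.
  congr ((_ + _) * _); rewrite mulrC mulrCA mulr_sumr mulr_sumr.
  by apply: eq_bigr => i _; ring.
have iS : mu.-integrable D (fun x => \sum_(i < n) (G i x)%:E)%E.
  by apply: (@integrable_sum _ _ _ _ _ (measurable_eball r) _ _ xpredT) => i _; exact: iG.
split.
  apply: (eq_integrable (measurable_eball r)) iS.
  by move=> x; rewrite inE => Dx /=; rewrite E// sumEFin.
rewrite /Rintegral (eq_integral (fun x => \sum_(i < n) (G i x)%:E)%E).
  by rewrite (integral_sum (measurable_eball r))// big1.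
by move=> x; rewrite inE => Dx /=; rewrite E// sumEFin.
Qed.

End radial_weak_solution.

(** * The logarithm below [1/e] *)

Section einv_lemmas.
Context {R : realType}.

Lemma einv_gt0 : 0 < einv :> R.
Proof. by rewrite invr_gt0 expR_gt0. Qed.

Lemma einv_lt1 : einv < 1 :> R.
Proof. by rewrite invf_lt1 ?expR_gt0// expR_gt1. Qed.

(** Makes [S = einv] admissible for the ball of radius [einv]. *)
Lemma sqr_einv_lt : einv ^+ 2 < einv :> R.
Proof. by rewrite expr2 -[ltRHS]mul1r ltr_pM2r ?einv_gt0 ?einv_lt1. Qed.

Lemma ln_einv : ln einv = -1 :> R.
Proof. by rewrite lnV ?posrE ?expR_gt0// expRK. Qed.

Lemma ln_lt_einv (s : R) : 0 < s < einv -> ln s < -1.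
Proof. by move=> /andP[s0 se]; rewrite -ln_einv ltr_ln ?posrE// einv_gt0. Qed.

Lemma ln_dotrv n (x : 'rV[R]_n) : ln (dotrv x x) / 2 = ln (enorm x).
Proof.
(* At the origin both sides are 0, by the convention [ln 0 = 0]. *)
have [->|x0] := eqVneq x 0.
  rewrite -sqr_enorm enorm0.
  by rewrite expr0n/= ln0// mul0r.
by rewrite -sqr_enorm lnXn ?enorm_gt0// -(mulr_natr (ln _)) mulfK.
Qed.

(** With [t = s^(-1/2) >= 1], [ln s / 2 = - ln t] and [0 <= ln t < t]. *)
Lemma sqr_half_ln_le (s : R) : 0 < s < einv -> (ln s / 2) ^+ 2 <= s^-1.
Proof.
move=> /[dup] /ln_lt_einv ls /andP[s0 se].
have t0 : 0 < Num.sqrt s^-1 by rewrite sqrtr_gt0 invr_gt0.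
have -> : ln s / 2 = - ln (Num.sqrt s^-1).
  have : ln (Num.sqrt s^-1 ^+ 2) = - ln s by rewrite sqr_sqrtr ?invr_ge0 ?ltW// lnV.
  by rewrite lnXn// => /(congr1 (fun z => z / 2)); rewrite -(mulr_natr (ln _)) mulfK// => ->;
    rewrite mulNr opprK.
rewrite sqrrN -[leRHS]sqr_sqrtr ?invr_ge0 ?(ltW s0)//.
have := ln_sublinear t0.
have : 0 <= ln (Num.sqrt s^-1).
  apply: ln_ge0; rewrite -sqrtr1 ler_wsqrtr//.
  by rewrite invf_ge1//; apply: ltW; exact: lt_trans se einv_lt1.
by move=> l0 lt; rewrite lerXn2r// ?nnegrE// ltW.
Qed.

End einv_lemmas.

(** * The profiles of [u] and [v] as functions of [s = |x|^2] *)

Section u_v_profiles.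
Context {R : realType}.
Implicit Types s : R.

(** Here [ln s / 2] stands for [ln |x|]. A slope is twice the derivative of its profile, that is,
    the factor of [x] in the gradient; a primed slope is the derivative of the slope. *)
Definition u_profile s := - (ln s / 2) - 1.
Definition u_slope s := - s^-1.
Definition u_slope' s := (s ^+ 2)^-1.

Definition v_profile s := (- (ln s / 2))^-1.
Definition v_slope s := (s * (ln s / 2) ^+ 2)^-1.
Definition v_slope' s :=
  - (s ^+ 2)^-1 * (((ln s / 2) ^+ 2)^-1 + ((ln s / 2) ^+ 3)^-1).

Let sE s : 0 < s < einv -> 0 < s. Proof. by case/andP. Qed.

Let s1 s : 0 < s < einv -> 1 <= s^-1.
Proof.
move=> /andP[s0 se]; rewrite invf_ge1//; apply: ltW; exact: lt_trans se einv_lt1.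
Qed.

Let is_derive_half_ln s : 0 < s -> is_derive s (1 : R) (fun t => ln t / 2) (s^-1 / 2).
Proof.
move=> s0; have d := is_derive1_ln s0.
have -> : (fun t : R => ln t / 2) = (2^-1 : R) *: (@ln R).
  by apply/funext => t; rewrite /= mulrC.
by apply: is_derive_eq; rewrite /GRing.scale/= mulrC.
Qed.

Let is_derive_inv s : s != 0 -> is_derive s (1 : R) (fun t : R => t^-1) (- (s ^+ 2)^-1).
Proof.
move=> s0; apply: (is_derive_eq (@is_deriveV R id s 1 1 s0 _)).
by rewrite /GRing.scale/= mulr1.
Qed.

Lemma is_derive_u_profile s : 0 < s -> is_derive s 1 u_profile (u_slope s / 2).
Proof.
move=> s0; have d := is_derive_half_ln s0.
have -> : u_profile = - (fun t => ln t / 2) - cst 1 by [].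
have d1 := is_deriveB (is_deriveN d) (is_derive_cst (1 : R) s (1 : R)).
apply: (is_derive_eq d1).
by rewrite subr0 /u_slope mulNr.
Qed.

Lemma is_derive_u_slope s : 0 < s -> is_derive s 1 u_slope (u_slope' s).
Proof.
move=> s0; have d := @is_derive_inv s (lt0r_neq0 s0).
have -> : u_slope = - (fun t => t^-1) by [].
by apply: (is_derive_eq (is_deriveN d)); rewrite opprK.
Qed.

Let half_ln_lt0 s : 0 < s < einv -> ln s / 2 < - 2^-1.
Proof. by move=> /ln_lt_einv; lra. Qed.

Let half_ln_neq0 s : 0 < s < einv -> ln s / 2 != 0.
Proof. by move=> /half_ln_lt0 h; rewrite lt_eqF//; lra. Qed.

Lemma is_derive_v_profile s : 0 < s < einv -> is_derive s 1 v_profile (v_slope s / 2).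
Proof.
move=> ss; have s0 := sE ss; have d := is_derive_half_ln s0.
have l0 := half_ln_neq0 ss.
have n0 : - (ln s / 2) != 0 by rewrite oppr_eq0.
apply: (is_derive_eq (is_deriveV (f := fun t => - (ln t / 2)) n0 (is_derive_opp d))).
rewrite /v_slope /GRing.scale/=.
by move: l0; set l := ln s / 2 => l0; field; rewrite l0 gt_eqF.
Qed.

Lemma is_derive_v_slope s : 0 < s < einv -> is_derive s 1 v_slope (v_slope' s).
Proof.
move=> ss; have s0 := sE ss; have d := is_derive_half_ln s0.
have l0 := half_ln_neq0 ss.
have dg := is_derive_mul (is_derive_id s (1 : R)) (is_derive_mul d d).
have g0 : s * (ln s / 2 * (ln s / 2)) != 0 by apply: mulf_neq0; [rewrite gt_eqF|exact: mulf_neq0].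
have -> : v_slope = (fun t => (t * (ln t / 2 * (ln t / 2)))^-1).
  by apply/funext => t; rewrite /v_slope expr2.
apply: (is_derive_eq (is_deriveV (f := fun t => t * (ln t / 2 * (ln t / 2))) g0 dg)).
rewrite /v_slope' /GRing.scale/=.
by move: l0; set l := ln s / 2 => l0; field; rewrite l0 gt_eqF.
Qed.

Let is_derive_continuous (f : R -> R) s (df : R) :
  is_derive s 1 f df -> {for s, continuous f}.
Proof. by case=> d _; apply/differentiable_continuous/derivable1_diffP. Qed.

Lemma u_slope'_continuous s : 0 < s < einv -> {for s, continuous u_slope'}.
Proof.
move=> ss; have s0 := sE ss; have d := is_derive_id s (1 : R).
have g0 : s * s != 0 by rewrite mulf_eq0 negb_or gt_eqF.
exact: is_derive_continuous (is_deriveV (f := fun t => t * t) g0 (is_derive_mul d d)).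
Qed.

Lemma v_slope'_continuous s : 0 < s < einv -> {for s, continuous v_slope'}.
Proof.
move=> ss; have s0 := sE ss; have d := is_derive_half_ln s0.
have l0 := half_ln_neq0 ss.
have di := is_deriveV (f := fun t => ln t / 2) l0 d.
have dd := is_derive_id s (1 : R).
have g0 : s * s != 0 by rewrite mulf_eq0 negb_or gt_eqF.
have ds := is_deriveV (f := fun t => t * t) g0 (is_derive_mul dd dd).
have d2 := is_derive_mul di di.
have dD := is_deriveD d2 (is_derive_mul di d2).
rewrite (_ : v_slope' = fun t => - (t * t)^-1 * ((ln t / 2)^-1 * (ln t / 2)^-1 +
  (ln t / 2)^-1 * ((ln t / 2)^-1 * (ln t / 2)^-1))).
  exact: is_derive_continuous (is_derive_mul (is_derive_opp ds) dD).
by apply/funext => t; rewrite /v_slope' !exprS expr0 !mulr1 !invfM.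
Qed.

(** With [l = ln s / 2 < -1/2], [(l + 1)^2 = l^2 + 2 l + 1 < l^2 <= 1/s]. The generous 4 is one
    constant for all bounds on [u]. *)
Lemma u_profile_sqr_le s : 0 < s < einv -> u_profile s ^+ 2 <= 4 / s.
Proof.
move=> ss; have := sqr_half_ln_le ss; have := half_ln_lt0 ss; have := s1 ss.
rewrite /u_profile; move: (ln s / 2) (s^-1) => l t t1 l0 lt.
by have := mulr_ge0 (ltW (lt_le_trans ltr01 t1)) (ltW (lt_le_trans ltr01 t1)); nra.
Qed.

Lemma u_profile_le s : 0 < s < einv -> `|u_profile s| <= 4 / s.
Proof.
move=> ss; have := sqr_half_ln_le ss; have := half_ln_lt0 ss; have := s1 ss.
rewrite /u_profile ler_norml; move: (ln s / 2) (s^-1) => l t t1 l0 lt.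
by apply/andP; split; nra.
Qed.

Lemma u_slope_le s : 0 < s < einv -> `|u_slope s| <= 4 / s.
Proof.
move=> ss; have s0 := sE ss.
have si : 0 < s^-1 by rewrite invr_gt0.
by rewrite /u_slope normrN gtr0_norm//; lra.
Qed.

Lemma u_slope'_le s : 0 < s < einv -> `|u_slope' s| <= 4 / s ^+ 2.
Proof.
move=> ss; have s0 := sE ss.
have si : 0 < (s ^+ 2)^-1 by rewrite invr_gt0 exprn_gt0.
by rewrite /u_slope' gtr0_norm//; lra.
Qed.

(** Below [1/e] the logarithm stays away from 0, so every logarithmic factor of [v] is bounded and
    only the powers of [s] are singular. *)
Let inv_half_ln_le s : 0 < s < einv -> `|(ln s / 2)^-1| <= 2.
Proof.
move=> ss; have l0 := half_ln_lt0 ss.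
rewrite normfV -[leRHS]invrK lef_pV2 ?posrE ?invr_gt0 ?normr_gt0 ?half_ln_neq0//.
by rewrite ltr0_norm; lra.
Qed.

Lemma v_profile_sqr_le s : 0 < s < einv -> v_profile s ^+ 2 <= 12 / s.
Proof.
move=> ss; have := inv_half_ln_le ss; have := s1 ss.
rewrite /v_profile invrN sqrrN -real_normK ?num_real//.
by move: (s^-1) `|_| (normr_ge0 (ln s / 2)^-1) => t l l0 t1 l2; nra.
Qed.

Lemma v_profile_le s : 0 < s < einv -> `|v_profile s| <= 12 / s.
Proof.
move=> ss; have := inv_half_ln_le ss; have := s1 ss.
by rewrite /v_profile invrN normrN; move: (s^-1) `|_| => t l t1 l2; lra.
Qed.

Lemma v_slope_le s : 0 < s < einv -> `|v_slope s| <= 12 / s.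
Proof.
move=> ss; have := inv_half_ln_le ss; have s0 := sE ss.
have -> : `|v_slope s| = `|(ln s / 2)^-1| ^+ 2 / s.
  by rewrite /v_slope normfV normrM (gtr0_norm s0) normrX normfV invfM exprVn mulrC.
move=> l2; apply: ler_wpM2r; first by rewrite invr_ge0 ltW.
by move: `|_| (normr_ge0 (ln s / 2)^-1) l2 => l l0 l2; nra.
Qed.

(** The source of the constant 12 in all bounds on [v]: with [|l|^-1 <= 2],
    [l^-2 + |l|^-3 <= 4 + 8]. *)
Lemma v_slope'_le s : 0 < s < einv -> `|v_slope' s| <= 12 / s ^+ 2.
Proof.
move=> ss; have := inv_half_ln_le ss; have s0 := sE ss.
rewrite /v_slope' normrM normrN [`|(s ^+ 2)^-1|]gtr0_norm ?invr_gt0 ?exprn_gt0//.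
rewrite (mulrC 12) => l2; apply: ler_wpM2l; first by rewrite invr_ge0 exprn_ge0// ltW.
apply: le_trans (ler_normD _ _) _; rewrite -!exprVn !normrX.
move: `|_| (normr_ge0 (ln s / 2)^-1) l2 => l l0 l2.
have l4 : l ^+ 2 <= 4 by nra.
by rewrite [l ^+ 3]exprS; nra.
Qed.

Let measurable_half_ln : measurable_fun setT (fun s : R => ln s / 2).
Proof. by apply: measurable_funM => //; exact: measurable_ln. Qed.

Lemma measurable_u_profile : measurable_fun setT u_profile.
Proof. by apply: measurable_funB => //; apply: measurableT_comp. Qed.

Lemma measurable_u_slope : measurable_fun setT u_slope.
Proof. by apply: measurableT_comp => //; exact: measurable_invr. Qed.

Lemma measurable_u_slope' : measurable_fun setT u_slope'.
Proof. by apply: measurable_funV; exact: measurable_funX. Qed.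

Lemma measurable_v_profile : measurable_fun setT v_profile.
Proof. by apply: measurable_funV; apply: measurableT_comp. Qed.

Lemma measurable_v_slope : measurable_fun setT v_slope.
Proof.
by apply: measurable_funV; apply: measurable_funM => //; exact: measurable_funX.
Qed.

Lemma measurable_v_slope' : measurable_fun setT v_slope'.
Proof.
apply: measurable_funM.
  by apply: measurableT_comp => //; apply: measurable_funV; exact: measurable_funX.
by apply: measurable_funD; apply: measurable_funV; exact: measurable_funX.
Qed.

End u_v_profiles.

(** * The equations of [u] and [v] *)

Section u_v_equations.
Context {R : realType} {n : nat} (n3 : (3 <= n)%N).
Local Notation mu := (lebesgue_rV R n).
Local Notation D := (eball einv : set 'rV[R]_n).

Let sE (s : R) : 0 < s < einv -> 0 < s. Proof. by case/andP. Qed.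

Definition grad_u (x : 'rV[R]_n) := radial_grad u_slope x.
Definition grad_v (x : 'rV[R]_n) := radial_grad v_slope x.

Lemma u_exE : u_ex = radial u_profile :> ('rV[R]_n -> R).
Proof. by apply/funext => x; rewrite /radial /u_profile ln_dotrv. Qed.

Lemma v_exE : v_ex = radial v_profile :> ('rV[R]_n -> R).
Proof. by apply/funext => x; rewrite /radial /v_profile ln_dotrv. Qed.

Lemma dotrvZ (a b : R) (x : 'rV[R]_n) : dotrv (a *: x) (b *: x) = a * b * dotrv x x.
Proof. by rewrite /dotrv mulr_sumr; apply: eq_bigr => i _; rewrite !mxE; ring. Qed.

Lemma W12_with_u : W12_with D u_ex grad_u.
Proof.
rewrite u_exE.
exact: (W12_with_radial n3 (ltW einv_lt1) sqr_einv_lt (ler0n R 4)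
  (fun s ss => is_derive_u_profile (sE ss)) (fun s ss => is_derive_u_slope (sE ss))
  u_profile_le u_slope_le
  measurable_u_profile measurable_u_slope u_profile_sqr_le).
Qed.

Lemma W12_with_v : W12_with D v_ex grad_v.
Proof.
rewrite v_exE.
exact: (W12_with_radial n3 (ltW einv_lt1) sqr_einv_lt (ler0n R 12)
  is_derive_v_profile is_derive_v_slope v_profile_le v_slope_le
  measurable_v_profile measurable_v_slope v_profile_sqr_le).
Qed.

(** With [H = -1/s], both [c . g] and [n H + 2 s H'] equal [- (n - 2) / s]. *)
Lemma weak_form_u phi : Cc_infty D phi ->
  mu.-integrable D (EFin \o weak_form c_ex grad_u phi) /\
  \int[mu]_(x in D) weak_form c_ex grad_u phi x = 0.
Proof.
apply: (weak_form_radial n3 (ltW einv_lt1) sqr_einv_lt (ler0n R 4)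
  (fun s ss => is_derive_u_slope (sE ss)) u_slope'_continuous u_slope_le u_slope'_le
  measurable_u_slope measurable_u_slope').
move=> x Dx; rewrite /c_ex /radial_grad dotrvZ sqr_enorm /u_slope /u_slope'.
have [->|q0] := eqVneq (dotrv x x) 0; first by rewrite !(invr0, mulr0, oppr0, addr0, mul0r).
by field.
Qed.

(** With [l = ln |x|] and [H = 1 / (s l^2)], both [c' . g] and [n H + 2 s H'] equal
    [(n - 2) / (s l^2) - 2 / (s l^3)]. The last term comes from differentiating the logarithm in
    [H]; the second summand of [c'] is there to match it. *)
Lemma weak_form_v phi : Cc_infty D phi ->
  mu.-integrable D (EFin \o weak_form c'_ex grad_v phi) /\
  \int[mu]_(x in D) weak_form c'_ex grad_v phi x = 0.
Proof.
apply: (weak_form_radial n3 (ltW einv_lt1) sqr_einv_lt (ler0n R 12)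
  is_derive_v_slope v_slope'_continuous v_slope_le v_slope'_le
  measurable_v_slope measurable_v_slope').
move=> x Dx; rewrite /c'_ex /radial_grad -scalerBl dotrvZ sqr_enorm /v_slope /v_slope'.
rewrite -ln_dotrv.
(* The identity is required at every point of the ball; at the origin both sides are 0 because
   [0^-1 = 0]. *)
have [->|q0] := eqVneq (dotrv x x) 0; first by rewrite !(invr0, mulr0, oppr0, addr0, mul0r).
have l0 : ln (dotrv x x) / 2 != 0.
  suff : ln (dotrv x x) < -1 by move=> h; rewrite lt_eqF//; lra.
  apply: ln_lt_einv; rewrite lt0r q0 dotrv_ge0/=.
  by rewrite -sqr_enorm; apply: lt_trans sqr_einv_lt; rewrite ltrXn2r// enorm_ge0.
by move: l0; set l := ln _ / 2 => l0; field; rewrite l0.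
Qed.

Lemma weak_solution_u : weak_solution D c_ex u_ex.
Proof.
by exists grad_u; [have [] := W12_with_u|exact: weak_form_u].
Qed.

Lemma weak_solution_v : weak_solution D c'_ex v_ex.
Proof.
by exists grad_v; [have [] := W12_with_v|exact: weak_form_v].
Qed.

End u_v_equations.

(** * The coefficients and the behaviour at the origin *)

Section weak_Ln_bound.
Context {R : realType} {n : nat}.
Local Notation mu := (lebesgue_rV R n).

Lemma enormZ (a : R) (x : 'rV[R]_n) : enorm (a *: x) = `|a| * enorm x.
Proof. by rewrite /enorm dotrvZ -expr2 sqrtrM ?sqr_ge0// sqrtr_sqr. Qed.

(** The set where [|c| > t] lies in the ball of radius [C / t], of measure at most [(2 C / t)^n].
    The level [t = 2 C / tau^(1/n)] makes this equal to [tau], so the norm is at most [2 C]. *)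
Lemma weak_Ln_inv_enorm (D : set 'rV[R]_n) c (C : R) : (0 < n)%N -> 0 < C ->
  measurable D -> measurable_fun D c ->
  (forall x, D x -> enorm (c x) <= C / enorm x) -> weak_Ln D c.
Proof.
move=> n0 C0 mD mc cC; split=> //.
apply: (@le_lt_trans _ _ (2 * C)%:E); last exact: ltry.
apply: ge_ereal_sup => _ [tau /= tau0 <-].
pose t := 2 * C / tau `^ n%:R^-1.
have tn0 : 0 < tau `^ n%:R^-1 by rewrite powR_gt0.
have t0 : 0 < t by rewrite divr_gt0// mulr_gt0.
have -> : (2 * C)%:E = ((tau `^ n%:R^-1)%R%:E * t%:E)%E.
  by rewrite -EFinM /t (mulrC (tau `^ _)) divfK// gt_eqF.
apply: lee_wpmul2l; first by rewrite lee_fin ltW.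
apply: ereal_inf_lbound; exists t => //; split => //.
have Ct0 : 0 <= C / t by rewrite divr_ge0// ltW.
apply: (@le_trans _ _ (mu (eball (C / t)))).
  apply: le_measure; rewrite ?inE.
  - have mh : measurable_fun D (enorm \o c).
      by apply: measurableT_comp => //; exact: measurable_enorm.
    have := mh mD _ (measurable_itv `]t, +oo[).
    congr (measurable _); apply/seteqP; split => x [Dx /=]; rewrite in_itv/= andbT.
      by rewrite ger0_norm ?enorm_ge0.
    by rewrite ger0_norm ?enorm_ge0.
  - exact: measurable_eball.
  - move=> x [Dx] /=; rewrite ger0_norm ?enorm_ge0// => tc.
    have := lt_le_trans tc (cC x Dx).
    (* At the origin the bound [C / |x|] is 0 by convention, so this point is not in the superlevel
       set. *)
    have [x0|x0] := eqVneq (enorm x) 0.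
      by rewrite x0 invr0 mulr0 => /(lt_trans t0); rewrite ltxx.
    have xp : 0 < enorm x by rewrite lt0r x0 enorm_ge0.
    by rewrite ltr_pdivlMr// => h; rewrite /eball/= ltr_pdivlMr// mulrC.
apply: le_trans (lebesgue_rV_eball_le _) _ => //.
rewrite lee_fin /t (_ : 2 * (C / _) = tau `^ n%:R^-1); last first.
  by field; rewrite !gt_eqF.
have nn : n%:R != 0 :> R by rewrite pnatr_eq0 -lt0n.
by rewrite -powR_mulrn ?powR_ge0// -powRrM mulVf// powRr1// ltW.
Qed.

End weak_Ln_bound.

Section coefficients.
Context {R : realType} {n : nat} (n3 : (3 <= n)%N).
Local Notation mu := (lebesgue_rV R n).
Local Notation D := (eball einv : set 'rV[R]_n).

Let n0 : (0 < n)%N. Proof. exact: leq_trans n3. Qed.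
Let nR : 3 <= n%:R :> R. Proof. by rewrite ler_nat. Qed.

Lemma measurable_scale (f : 'rV[R]_n -> R) : measurable_fun setT f ->
  measurable_fun setT (fun x => f x *: x).
Proof.
move=> mf; apply: measurable_fun_coorP => i.
under eq_fun do rewrite mxE.
by apply: measurable_funM => //; exact: measurable_coor.
Qed.

Let mV (f : 'rV[R]_n -> R) (a : R) : measurable_fun setT f ->
  measurable_fun setT (fun x => a / f x).
Proof. by move=> mf; apply: measurable_funM => //; exact: measurable_funV. Qed.

Let menorm := @measurable_enorm R n.

Let enorm_scale_le (a C : R) (x : 'rV[R]_n) : `|a| <= C / enorm x ^+ 2 ->
  enorm (a *: x) <= C / enorm x.
Proof.
move=> aC; rewrite enormZ.
have [x0|x0] := eqVneq (enorm x) 0; first by rewrite x0 invr0 !mulr0.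
have xp : 0 < enorm x by rewrite lt0r x0 enorm_ge0.
apply: le_trans (ler_wpM2r (ltW xp) aC) _.
by rewrite le_eqVlt; apply/orP; left; apply/eqP; field.
Qed.

Lemma weak_Ln_c_ex : weak_Ln D c_ex.
Proof.
apply: (@weak_Ln_inv_enorm _ _ _ _ (n%:R - 2)) => //.
- by have := nR; lra.
- exact: measurable_eball.
- apply: measurable_funTS; apply: measurable_scale; apply: mV.
  exact: measurable_funX.
- move=> x Dx; apply: enorm_scale_le.
  by rewrite ger0_norm// divr_ge0 ?sqr_ge0//; have := nR; lra.
Qed.

Lemma ln_enorm_lt (x : 'rV[R]_n) : D x -> x != 0 -> ln (enorm x) < -1.
Proof. by move=> Dx x0; apply: ln_lt_einv; rewrite enorm_gt0 x0. Qed.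

(** As [ln |x| < -1], the logarithmic summand adds between 0 and 2 to the factor [n - 2], whence the
    constant [n]. *)
Lemma weak_Ln_c'_ex : weak_Ln D c'_ex.
Proof.
apply: (@weak_Ln_inv_enorm _ _ _ _ n%:R) => //.
- by have := nR; lra.
- exact: measurable_eball.
- apply: measurable_funTS.
  rewrite (_ : c'_ex = fun x : 'rV[R]_n => ((n%:R - 2) / enorm x ^+ 2 -
     2 / (enorm x ^+ 2 * ln (enorm x))) *: x); last first.
    by apply/funext => x; rewrite /c'_ex scalerBl.
  apply: measurable_scale; apply: measurable_funB; apply: mV.
    exact: measurable_funX.
  apply: measurable_funM; first exact: measurable_funX.
  by apply: measurableT_comp => //; exact: measurable_ln.
- move=> x Dx; rewrite /c'_ex -scalerBl; apply: enorm_scale_le.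
  have [->|x0] := eqVneq x 0.
    rewrite enorm0.
    by rewrite expr0n/= mul0r !invr0 !mulr0 subrr normr0.
  have l1 := ln_enorm_lt Dx x0.
  have q0 : 0 < (enorm x ^+ 2)^-1 by rewrite invr_gt0 exprn_gt0// enorm_gt0.
  rewrite (_ : _ - _ = (n%:R - 2 - 2 * (ln (enorm x))^-1) * (enorm x ^+ 2)^-1); last first.
    by rewrite [(_ * ln _)^-1]invfM [RHS]mulrBl; congr (_ - _); rewrite mulrCA mulrC.
  rewrite normrM (gtr0_norm q0).
  apply: ler_wpM2r; first exact: ltW.
  have li : 0 <= - (ln (enorm x))^-1 <= 1.
    rewrite -invrN invr_ge0 invf_le1; last by lra.
    by apply/andP; split; lra.
  by rewrite ler_norml; have := nR; move: li => /andP[li1 li2] nR3; apply/andP; split; lra.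
Qed.

Lemma ae_exists (P : 'rV[R]_n -> Prop) (A : set 'rV[R]_n) :
  measurable A -> (0 < mu A)%E -> (\forall x \ae mu, P x) -> exists2 x, A x & P x.
Proof.
move=> mA A0 [N [mN N0 PN]]; apply: contrapT => h.
have : (mu A <= mu N)%E.
  apply: le_measure; rewrite ?inE// => x Ax; apply: PN => Px.
  by apply: h; exists x.
by rewrite N0 leNgt A0.
Qed.

(** Small balls have positive measure and the origin is null; an almost everywhere statement thus
    has a witness near 0 at which the formulas for [u] and [v] are meaningful. *)
Lemma ae_exists_eball (P : 'rV[R]_n -> Prop) (d : R) : 0 < d ->
  (\forall x \ae mu, P x) -> exists x, [/\ enorm x < d, x != 0 & P x].
Proof.
move=> d0 aeP.
have [|||x xd [x0 Px]] := @ae_exists (fun x => x != 0 /\ P x) (eball d).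
- exact: measurable_eball.
- exact: lebesgue_rV_eball_gt0.
- by apply: filterS2 (ae_neq0 n0) aeP => x; split.
- by exists x.
Qed.

Lemma u_ex_unbounded (r : R) : 0 < r -> ~ ess_bounded (eball r) (u_ex : 'rV[R]_n -> R).
Proof.
move=> r0 [M hM].
(* At such a distance from 0, [u] exceeds [|M| + 1]. *)
have d0 : 0 < Num.min r (expR (- (`|M| + 2))) by rewrite lt_min r0 expR_gt0.
have [x [+ x0 xM]] := ae_exists_eball d0 hM.
rewrite lt_min => /andP[xr xe].
have := xM xr; rewrite /u_ex.
have lx : ln (enorm x) < - (`|M| + 2).
  by rewrite -[ltRHS]expRK ltr_ln// ?posrE ?expR_gt0// enorm_gt0.
have := ler_norm M.
have := ler_norm (- ln (enorm x) - 1).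
by move: lx; lra.
Qed.

Lemma u_ex_ge0 (x : 'rV[R]_n) : x != 0 -> D x -> 0 <= u_ex x.
Proof. by move=> x0 Dx; have := ln_enorm_lt Dx x0; rewrite /u_ex; lra. Qed.

Lemma v_ex_gt0 (x : 'rV[R]_n) : x != 0 -> D x -> 0 < v_ex x.
Proof. by move=> x0 Dx; have := ln_enorm_lt Dx x0; rewrite /v_ex invr_gt0; lra. Qed.

Lemma v_ex_small (e : R) : 0 < e -> exists2 d : R, 0 < d &
  forall x : 'rV[R]_n, enorm x < d -> `|v_ex x| < e.
Proof.
move=> e0; exists (Num.min einv (expR (- e^-1))).
  by rewrite lt_min einv_gt0 expR_gt0.
move=> x; rewrite lt_min => /andP[xe xd].
have [->|x0] := eqVneq x 0.
  rewrite /v_ex enorm0.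
  by rewrite ln0// oppr0 invr0 normr0.
rewrite gtr0_norm; last exact: v_ex_gt0.
have lx : ln (enorm x) < - e^-1.
  by rewrite -[ltRHS]expRK ltr_ln// ?posrE ?expR_gt0// enorm_gt0.
have ei : 0 < e^-1 by rewrite invr_gt0.
by rewrite /v_ex -[ltRHS]invrK ltf_pV2 ?posrE; lra.
Qed.

Lemma v_ex_cvg0 : v_ex x @[x --> (0 : 'rV[R]_n)^'] --> (0 : R).
Proof.
apply/cvgrPdist_lt => e e0; have [d d0 hd] := v_ex_small e0.
apply: nbhs_dnbhs.
have : nbhs (0 : 'rV[R]_n) (eball d).
  apply: open_nbhs_nbhs; split; first exact: open_eball.
  by rewrite /eball/= enorm0.
by apply: filterS => x xd; rewrite sub0r normrN; exact: hd.
Qed.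

Lemma v_ex_nonzero (r : R) : 0 < r ->
  ~ (\forall x \ae mu, (eball r : set 'rV[R]_n) x -> v_ex x = 0).
Proof.
move=> r0 h.
have d0 : 0 < Num.min r einv :> R by rewrite lt_min r0 einv_gt0.
have [x [+ x0 xv]] := ae_exists_eball d0 h.
rewrite lt_min => /andP[xr xe]; have := v_ex_gt0 x0 xe.
by rewrite (xv xr) ltxx.
Qed.

Lemma ess_inf_v_ex (r : R) : 0 < r <= einv ->
  ess_inf_on (eball r : set 'rV[R]_n) v_ex = 0%E.
Proof.
move=> /andP[r0 re]; apply/eqP; rewrite eq_le; apply/andP; split; last first.
  apply/ess_infP; apply: filterS (ae_neq0 n0) => x x0; rewrite /patch.
  case: ifPn => [/set_mem xr|_]; last exact: leey.
  rewrite /= lee_fin ltW//; apply: v_ex_gt0 => //.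
  exact: lt_le_trans xr re.
apply/lee_addgt0Pr => e e0; rewrite add0e.
have [d d0 hd] := v_ex_small e0.
have m0 : 0 < Num.min r d by rewrite lt_min r0.
have [x [+ x0 xi]] := ae_exists_eball m0
  (ess_inf_le mu (patch (cst +oo%E) (eball r : set 'rV[R]_n) (EFin \o v_ex))).
rewrite lt_min => /andP[xr xd]; apply: le_trans xi _.
rewrite /patch mem_set//= lee_fin; apply: ltW.
exact: le_lt_trans (ler_norm _) (hd _ xd).
Qed.

(** A zero integral would make [v^a] vanish almost everywhere, contradicting [v > 0] at a point
    other than the origin. *)
Lemma power_mean_v_ex_gt0 (a r : R) : 0 < r <= einv ->
  (0 < power_mean a (eball r : set 'rV[R]_n) v_ex)%E.
Proof.
move=> /andP[r0 re].
have mr := measurable_eball r : measurable (eball r : set 'rV[R]_n).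
rewrite /power_mean; apply: poweR_gt0; apply: mule_gt0.
  have mfin : mu (eball r) \is a fin_num.
    by rewrite ge0_fin_numE ?measure_ge0// lebesgue_rV_eball_fin.
  have m0 : 0 < fine (mu (eball r)).
    by rewrite -lte_fin fineK//; exact: lebesgue_rV_eball_gt0.
  by rewrite -(fineK mfin) inver (gt_eqF m0) lte_fin invr_gt0.
rewrite lt0e integral_ge0 ?andbT; last by move=> x _; rewrite lee_fin powR_ge0.
apply/eqP => I0.
have mv : measurable_fun (eball r) (fun x : 'rV[R]_n => v_ex x `^ a).
  apply: (@measurableT_comp _ _ _ _ _ _ (fun t : R => t `^ a)).
    exact: measurable_powR.
  have := (@measurable_radial R n r (@v_profile R) (@measurable_v_profile R)).
  by rewrite -v_exE.
have : ae_eq mu (eball r) (fun x => (v_ex x `^ a)%:E) (cst 0%E).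
  apply/ae_eq_integral_abs => //; first exact/measurable_EFinP.
  rewrite -[RHS]I0; apply: eq_integral => x _ /=.
  by rewrite ger0_norm ?powR_ge0.
move=> /(ae_exists_eball r0)[x [xr x0 vx]].
have /eqP : v_ex x `^ a = 0 by have /= [] := vx xr.
by rewrite gt_eqF// powR_gt0// v_ex_gt0//; exact: lt_le_trans xr re.
Qed.

End coefficients.

(** * Approximation of [u_ex] by test functions *)

Section bump.
Context {R : realType} (eta : R) (eta0 : 0 < eta).
Implicit Types t : R.

(** The factor [t^-k] makes the family stable under differentiation: all derivatives of
    [exp(- eta / t)] are linear combinations of its members. *)
Definition bump k t : R := if 0 < t then t ^- k * expR (- (eta / t)) else 0.

Lemma bump_gt0E k t : 0 < t -> bump k t = t ^- k * expR (- (eta / t)).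
Proof. by move=> t0; rewrite /bump t0. Qed.

Lemma bump_le0E k t : t <= 0 -> bump k t = 0.
Proof. by move=> t0; rewrite /bump ltNge t0. Qed.

Let is_derive_bump_pos k t : 0 < t -> is_derive t 1
  (fun t => t ^- k * expR (- (eta / t))) (- k%:R * bump k.+1 t + eta * bump k.+2 t).
Proof.
move=> t0; have tn0 : t != 0 by rewrite gt_eqF.
have dv := is_deriveV (f := id) tn0 (is_derive_id t (1 : R)).
have d1 := is_deriveX k dv.
have d2 : is_derive t (1:R) (fun t => expR (- (eta / t))) (expR (- (eta / t)) * (eta / t ^+ 2)).
  apply: (@is_derive1_comp R expR (fun t => - (eta / t))).
  apply: (is_derive_eq (is_derive_opp (is_derive_mul (is_derive_cst eta t (1:R)) dv))).
  by rewrite mul0r addr0 /cst /GRing.scale/= mulr1 mulrN opprK.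
have E : (fun t : R => t ^- k) = (fun t => t^-1) ^+ k.
  by apply/funext => s; rewrite exprfctE exprVn.
rewrite -E in d1.
apply: (is_derive_eq (is_derive_mul d1 d2)).
rewrite !bump_gt0E// /GRing.scale/= mulr1 -!exprVn; clear -tn0.
move: (expR _) => a.
case: k => [|k]; first by rewrite !expr0 !expr1 !mul0r oppr0 !mul0r !add0r !addr0 exprVn; field.
by rewrite !exprVn /= !exprS; field; rewrite tn0 expf_neq0.
Qed.

(** With [m = k+2] and [y = eta / t], [exp(y/m) >= y/m] gives
    [exp(-y) <= (m/y)^m = (m t / eta)^(k+2)], which beats [t^-k] by [t^2]. A quadratic bound makes
    the derivative at 0 exist and vanish. *)
Let bump_quadratic k : exists2 C, 0 <= C & forall t, `|bump k t| <= C * t ^+ 2.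
Proof.
exists ((k.+2%:R / eta) ^+ k.+2); first by rewrite exprn_ge0// divr_ge0// ltW.
move=> t; have [t0|t0] := leP t 0.
  by rewrite bump_le0E// normr0 mulr_ge0 ?sqr_ge0 ?exprn_ge0// divr_ge0// ltW.
have tk0 : 0 < t ^- k by rewrite invr_gt0 exprn_gt0.
rewrite bump_gt0E// ger0_norm; last by rewrite mulr_ge0 ?expR_ge0// ltW.
have c0 : 0 < k.+2%:R / eta * t by rewrite mulr_gt0// divr_gt0.
have h : expR (- (eta / t)) <= (k.+2%:R / eta * t) ^+ k.+2.
  have -> : - (eta / t) = (- (eta / t) / k.+2%:R) *+ k.+2.
    by rewrite -[RHS]mulr_natr divfK.
  rewrite -[X in expR X]mulr_natr expRM_natr.
  apply: lerXn2r; rewrite ?nnegrE ?expR_ge0//; first exact: ltW.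
  have e : k.+2%:R / eta * t = (eta / t / k.+2%:R)^-1.
    by rewrite !invfM !invrK -(mulrA k.+2%:R) mulrC.
  rewrite e mulNr expRN lef_pV2 ?posrE ?expR_gt0 ?divr_gt0//.
  by apply: le_trans (expR_ge1Dx _); rewrite lerDr.
rewrite -ler_pdivlMl// invrK; apply: le_trans h _.
by rewrite exprMn [leRHS]mulrCA -(exprD t) addn2.
Qed.

Lemma is_derive_bump k t :
  is_derive t 1 (bump k) (- k%:R * bump k.+1 t + eta * bump k.+2 t).
Proof.
have [t0|t0|->] := ltgtP t 0.
- rewrite !bump_le0E ?ltW// !mulr0 addr0.
  apply: (@near_eq_is_derive _ _ _ (cst 0)).
  by near=> s; rewrite bump_le0E//; near: s; exact: lt_le_nbhsl.
- apply: near_eq_is_derive (is_derive_bump_pos k t0).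
  by near=> s; rewrite bump_gt0E//; near: s; exact: lt_nbhsr.
- rewrite !bump_le0E// !mulr0 addr0.
  have [C C0 bC] := bump_quadratic k.
  have cv : h^-1 *: ((bump k \o shift 0) (h *: (1:R)) - bump k 0) @[h --> 0^'] --> (0 : R).
    apply/cvgrPdist_le => e e0; near=> h.
    rewrite sub0r normrN /= addr0 [bump k 0]bump_le0E// subr0 /GRing.scale/= mulr1.
    have h0 : h != 0 by near: h; exact: nbhs_dnbhs_neq.
    rewrite normrM normfV ler_pdivrMl ?normr_gt0//.
    apply: le_trans (bC h) _; rewrite -real_normK ?num_real// expr2 mulrA mulrC.
    rewrite ler_wpM2l//.
    (* [C] may be 0, so [C + 1] is used as the divisor. *)
    apply: (@le_trans _ _ ((C + 1) * `|h|)); first by rewrite ler_wpM2r// lerDl.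
    have C1 : 0 < C + 1 by rewrite ltr_wpDl.
    rewrite -ler_pdivlMl//; near: h; apply: dnbhs0_le.
    by apply: mulr_gt0 => //; rewrite invr_gt0 ltr_wpDl.
  by split; [apply/cvg_ex; exists 0|exact: cvg_lim cv].
Unshelve. all: by end_near. Qed.

End bump.

(** * Smoothness and support of the approximations *)

Section smooth_class.
Context {R : realType} {n : nat}.

(** Smoothness quantifies over all iterated partial derivatives; a class of continuous functions
    stable under partial derivatives contains them all. *)
Lemma smooth_closed_class (P : ('rV[R]_n -> R) -> Prop) :
  (forall f, P f -> continuous f) ->
  (forall f i, P f -> exists2 g, P g &
    forall x, is_derive x (delta_mx ord0 i) f (g x)) ->
  forall f, P f -> smooth f.
Proof.
move=> Pc Pd f Pf.
have Pp h i : P h -> P (partial i h).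
  move=> /(Pd _ i)[g Pg hg]; rewrite (_ : partial i h = g)//.
  by apply/funext => x; exact: partialE.
have Pi s : P (iter_partial s f) by elim: s => //= i s; exact: Pp.
move=> s; split; first exact: Pc.
by move=> i x; have [g _ /(_ x)[]] := Pd _ i (Pi s).
Qed.

Variable eta : R.
Hypothesis eta0 : 0 < eta.

Let q (x : 'rV[R]_n) := dotrv x x + eta.

Definition u_reg (x : 'rV[R]_n) := u_profile (dotrv x x + eta).

Let q0 x : 0 < q x. Proof. by rewrite /q ltr_wpDl// dotrv_ge0. Qed.

(** The functions met when differentiating [u_test] repeatedly. As the derivative of [u_slope] is
    its own square, no further generator appears. *)
Inductive reg_class : ('rV[R]_n -> R) -> Prop :=
| reg_cst c : reg_class (cst c)
| reg_coor i : reg_class (fun x => x ord0 i)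
| reg_slope : reg_class (fun x => u_slope (dotrv x x + eta))
| reg_log : reg_class u_reg
| reg_bump k : reg_class (fun x => bump eta k (u_reg x))
| reg_add f g : reg_class f -> reg_class g -> reg_class (fun x => f x + g x)
| reg_mul f g : reg_class f -> reg_class g -> reg_class (fun x => f x * g x).

Let cont_comp (F : R -> R) (g : 'rV[R]_n -> R) :
  (forall x, exists l : R, is_derive (g x) 1 F l) -> continuous g ->
  continuous (fun x => F (g x)).
Proof.
move=> dF cg x; apply: (@continuous_comp _ _ _ g F); first exact: cg.
by have [l [d _]] := dF x; apply/differentiable_continuous/derivable1_diffP.
Qed.

Lemma is_derive_u_reg i x : is_derive x (delta_mx ord0 i) u_reg
  (u_slope (dotrv x x + eta) * x ord0 i).
Proof.
apply: (is_derive_eq (is_derive_comp1 (is_derive_u_profile (q0 x))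
  (is_derive_shift_dotrv eta x i))).
by rewrite /q; field.
Qed.

Lemma u_reg_continuous : continuous u_reg.
Proof.
apply: (cont_comp (F := u_profile)); last exact: shift_dotrv_continuous.
by move=> x; eexists; exact: is_derive_u_profile (q0 x).
Qed.

Lemma reg_class_smooth f : reg_class f -> smooth f.
Proof.
apply: smooth_closed_class.
- move=> {}f; elim=> [c|i|||k|{}f g _ cf _ cg|{}f g _ cf _ cg].
  + exact: cst_continuous.
  + exact: coor_continuous.
  + apply: (cont_comp (F := u_slope)); last exact: shift_dotrv_continuous.
    by move=> x; eexists; exact: is_derive_u_slope (q0 x).
  + exact: u_reg_continuous.
  + apply: (cont_comp (F := bump eta k)); last exact: u_reg_continuous.
    by move=> x; eexists; exact: is_derive_bump.
  + by move=> x; apply: (@continuousD R R 'rV[R]_n); [exact: cf|exact: cg].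
  + by move=> x; apply: continuousM; [exact: cf|exact: cg].
- move=> {}f i; elim=> [c|j|||k|{}f g Pf [f' Pf' df] Pg [g' Pg' dg]
                       |{}f g Pf [f' Pf' df] Pg [g' Pg' dg]].
  + exists (cst 0); first exact: reg_cst.
    by move=> x; exact: is_derive_cst.
  + exists (cst ((delta_mx (ord0 : 'I_1) i : 'rV[R]_n) ord0 j)); first exact: reg_cst.
    by move=> x; exact: is_derive_coor.
  + exists (fun x => u_slope (dotrv x x + eta) * u_slope (dotrv x x + eta) *
      (cst 2 x * x ord0 i)).
      apply: reg_mul; first exact: reg_mul reg_slope reg_slope.
      exact: reg_mul (reg_cst 2) (reg_coor i).
    move=> x; apply: (is_derive_eq (is_derive_comp1 (is_derive_u_slope (q0 x))
      (is_derive_shift_dotrv eta x i))).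
    by rewrite /u_slope' /u_slope /q mulrNN -invfM -expr2.
  + exists (fun x => u_slope (dotrv x x + eta) * x ord0 i).
      exact: reg_mul reg_slope (reg_coor i).
    by move=> x; exact: is_derive_u_reg.
  + exists (fun x => (cst (- k%:R) x * bump eta k.+1 (u_reg x) +
      cst eta x * bump eta k.+2 (u_reg x)) * (u_slope (dotrv x x + eta) * x ord0 i)).
      apply: reg_mul; last exact: reg_mul reg_slope (reg_coor i).
      by apply: reg_add; apply: reg_mul; do ?[exact: reg_cst|exact: reg_bump].
    move=> x; apply: is_derive_comp1; first exact: is_derive_bump.
    exact: is_derive_u_reg.
  + exists (fun x => f' x + g' x); first exact: reg_add.
    by move=> x; exact: is_deriveD (df x) (dg x).
  + exists (fun x => f x * g' x + f' x * g x).
      by apply: reg_add; exact: reg_mul.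
    by move=> x; exact: is_derive_mul.
Qed.

(* [t exp(- eta / t)], extended by 0 to [t <= 0], is smooth; since [u_reg] is
   negative near the boundary of the ball, no further cut-off is needed. *)
Definition u_test (x : 'rV[R]_n) := u_reg x * bump eta 0 (u_reg x).

(** The derivative of [t exp(- eta / t)] at [t = u_reg x], equal to [(1 + eta/t) exp(- eta/t)] for
    [t > 0]. *)
Definition u_test_factor (x : 'rV[R]_n) :=
  bump eta 0 (u_reg x) + eta * u_reg x * bump eta 2 (u_reg x).

Lemma partial_u_test i x : partial i u_test x =
  u_slope (dotrv x x + eta) * u_test_factor x * x ord0 i.
Proof.
apply: partialE.
apply: (is_derive_eq (is_derive_mul (is_derive_u_reg i x)
  (is_derive_comp1 (is_derive_bump eta0 0 _) (is_derive_u_reg i x)))).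
by rewrite oppr0 mul0r add0r /u_test_factor; ring.
Qed.

Lemma u_test_Cc_infty : Cc_infty (eball einv) u_test.
Proof.
(* [u_reg] is positive only where [|x|^2 + eta < einv^2], so the support keeps a distance from the
   sphere. *)
pose m : R := einv ^+ 2 - eta.
have sub : closure [set x | u_test x != 0] `<=` [set x | dotrv x x <= m].
  rewrite closureE; apply: smallest_sub.
    rewrite (_ : [set x | _] = (fun x : 'rV[R]_n => dotrv x x) @^-1` [set t | t <= m])//.
    apply: closed_comp; last exact: closed_le.
    by move=> x _; exact: dotrvv_continuous.
  move=> x /=; apply: contra_neqP => /negP; rewrite -ltNge => mx.
  rewrite /u_test bump_le0E ?mulr0// /u_reg /u_profile.
  have : ln (einv ^+ 2) < ln (dotrv x x + eta) :> R.
    have qq : 0 < dotrv x x + eta := q0 x.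
    rewrite ltr_ln ?posrE ?exprn_gt0 ?einv_gt0//.
    by move: mx; rewrite /m; lra.
  by rewrite lnXn ?einv_gt0// ln_einv; lra.
have sub' : closure [set x | u_test x != 0] `<=` eball einv.
  move=> x /sub /= xm; rewrite /eball/= -(@ltr_pXn2r _ 2) ?nnegrE ?enorm_ge0 ?ltW ?einv_gt0//.
  by rewrite sqr_enorm; move: xm eta0; rewrite /m; lra.
split=> //.
- by apply: reg_class_smooth; apply: reg_mul; [exact: reg_log|exact: reg_bump].
- apply: (subclosed_compact _ (compact_ccube (M := einv))); first exact: closed_closure.
  move=> x /sub' xe i; apply: ltW; exact: le_lt_trans (coor_le_enorm _ _) xe.
Qed.

(** [(1 + y) exp(-y) <= 1] with [y = eta / u_reg x], by [1 + y <= exp y]. *)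
Lemma u_test_factor_itv x : 0 <= u_test_factor x <= 1.
Proof.
rewrite /u_test_factor; have [t0|t0] := leP (u_reg x) 0.
  by rewrite !bump_le0E// mulr0 addr0 lexx ler01.
rewrite !bump_gt0E// expr0 invr1 mul1r.
rewrite (_ : _ + _ = (1 + eta / u_reg x) * expR (- (eta / u_reg x))); last first.
  by move: t0; move: (u_reg x) (expR _) => t a t0; field; rewrite gt_eqF.
have y0 : 0 <= eta / u_reg x by rewrite divr_ge0// ltW.
rewrite mulr_ge0 ?expR_ge0 ?addr_ge0//= expRN ler_pdivrMr ?expR_gt0// mul1r.
exact: expR_ge1Dx.
Qed.

Lemma u_test_itv x : x != 0 -> eball einv x -> 0 <= u_test x <= u_ex x.
Proof.
move=> x0 Dx; have u0 := u_ex_ge0 x0 Dx.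
rewrite /u_test; have [t0|t0] := leP (u_reg x) 0.
  by rewrite bump_le0E// mulr0 lexx.
rewrite bump_gt0E// expr0 invr1 mul1r.
apply/andP; split; first by rewrite mulr_ge0 ?expR_ge0// ltW.
have tu : u_reg x <= u_ex x.
  rewrite u_exE /radial /u_reg /u_profile.
  have qx : 0 < dotrv x x by rewrite -sqr_enorm exprn_gt0// enorm_gt0.
  have : ln (dotrv x x) <= ln (dotrv x x + eta).
    by rewrite ler_ln ?posrE ?q0// lerDl ltW.
  by lra.
apply: le_trans tu; rewrite ler_piMr//; first exact: ltW.
rewrite -[leRHS]expR0 ler_expR oppr_le0.
by rewrite divr_ge0// ltW.
Qed.

End smooth_class.

(** * Convergence of the approximations in [W^{1,2}] *)

Section regularization_limits.
Context {R : realType} {n : nat} (n3 : (3 <= n)%N).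
Local Notation mu := (lebesgue_rV R n).
Local Notation D := (eball einv : set 'rV[R]_n).
Variable e : nat -> R.
Hypothesis e0 : forall k, 0 < e k.
Hypothesis ecv : e k @[k --> \oo] --> (0 : R).

Let dot_gt0 (x : 'rV[R]_n) : x != 0 -> 0 < dotrv x x.
Proof. by move=> x0; rewrite -sqr_enorm exprn_gt0// enorm_gt0. Qed.

Let shift_cvg (x : 'rV[R]_n) : dotrv x x + e k @[k --> \oo] --> dotrv x x.
Proof. by rewrite -[X in _ --> X]addr0; apply: cvgD => //; exact: cvg_cst. Qed.

Let profile_cvg (F : R -> R) (l : R) (x : 'rV[R]_n) : is_derive (dotrv x x) 1 F l ->
  F (dotrv x x + e k) @[k --> \oo] --> F (dotrv x x).
Proof.
case=> d _; have cF : {for dotrv x x, continuous F}.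
  exact/differentiable_continuous/derivable1_diffP.
apply: continuous_cvg; [exact: cF|exact: shift_cvg].
Qed.

Let u_reg_cvg (x : 'rV[R]_n) : x != 0 -> u_reg (e k) x @[k --> \oo] --> u_ex x.
Proof.
move=> x0; rewrite u_exE.
exact: (@profile_cvg u_profile _ x (is_derive_u_profile (dot_gt0 x0))).
Qed.

Let u_ex_gt0 (x : 'rV[R]_n) : x != 0 -> D x -> 0 < u_ex x.
Proof. by move=> x0 Dx; have := ln_enorm_lt Dx x0; rewrite /u_ex; lra. Qed.

Let u_reg_gt0 (x : 'rV[R]_n) : x != 0 -> D x ->
  \forall k \near \oo, 0 < u_reg (e k) x.
Proof. by move=> x0 Dx; apply: (cvgr_gt _ (u_reg_cvg x0)); exact: u_ex_gt0. Qed.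

Let ratio_cvg (x : 'rV[R]_n) : x != 0 -> D x ->
  e k / u_reg (e k) x @[k --> \oo] --> (0 : R).
Proof.
move=> x0 Dx; rewrite -(mul0r (u_ex x)^-1); apply: cvgM => //.
by apply: cvgV; [rewrite gt_eqF// u_ex_gt0|exact: u_reg_cvg].
Qed.

Let exp_ratio_cvg (x : 'rV[R]_n) : x != 0 -> D x ->
  expR (- (e k / u_reg (e k) x)) @[k --> \oo] --> (1 : R).
Proof.
move=> x0 Dx; rewrite -(@expR0 R) -oppr0.
apply: continuous_cvg; first exact: continuous_expR.
exact: cvgN (ratio_cvg x0 Dx).
Qed.

(** In the open ball [u > 0], so [u_reg] is eventually positive and the cut-off is then
    [exp(- eta / u_reg)], which tends to 1. *)
Lemma u_test_cvg (x : 'rV[R]_n) : x != 0 -> D x ->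
  u_test (e k) x @[k --> \oo] --> u_ex x.
Proof.
move=> x0 Dx; rewrite -[X in _ --> X]mulr1.
apply: cvg_trans (cvgM (u_reg_cvg x0) (exp_ratio_cvg x0 Dx)).
apply: near_eq_cvg; near=> k.
rewrite /u_test bump_gt0E ?expr0 ?invr1 ?mul1r//.
by near: k; exact: u_reg_gt0.
Unshelve. all: by end_near. Qed.

Lemma u_test_factor_cvg (x : 'rV[R]_n) : x != 0 -> D x ->
  u_test_factor (e k) x @[k --> \oo] --> (1 : R).
Proof.
move=> x0 Dx.
have c1 : 1 + e k / u_reg (e k) x @[k --> \oo] --> (1 + 0 : R).
  by apply: cvgD; [exact: cvg_cst|exact: ratio_cvg].
have E : \forall k \near \oo, (1 + e k / u_reg (e k) x) *
    expR (- (e k / u_reg (e k) x)) = u_test_factor (e k) x.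
  near=> k; have t0 : 0 < u_reg (e k) x by near: k; exact: u_reg_gt0.
  rewrite /u_test_factor !bump_gt0E// expr0 invr1 mul1r.
  by move: t0; move: (u_reg _ x) (expR _) => t a t0; field; rewrite gt_eqF.
have h := cvgM c1 (exp_ratio_cvg x0 Dx); rewrite addr0 mulr1 in h.
exact: cvg_trans (near_eq_cvg E) (h _).
Unshelve. all: by end_near. Qed.

Let grad_diff (x : 'rV[R]_n) k : grad_u x - grad (u_test (e k)) x =
  (u_slope (dotrv x x) - u_slope (dotrv x x + e k) * u_test_factor (e k) x) *: x.
Proof.
apply/rowP => i; rewrite !mxE partial_u_test ?e0//.
by rewrite mulrBl.
Qed.

Lemma dirichlet_u_test_cvg :
  (\int[mu]_(x in D) (enorm (grad_u x - grad (u_test (e k)) x) ^+ 2)%:E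
    @[k --> \oo] --> 0)%E.
Proof.
have mgrad k i : measurable_fun D (fun x => (grad_u x - grad (u_test (e k)) x) ord0 i).
  rewrite (_ : (fun x => _) = fun x => grad_u x ord0 i - partial i (u_test (e k)) x); last first.
    by apply/funext => x; rewrite !mxE.
  apply: measurable_funB.
    exact: measurable_radial_grad (@measurable_u_slope R) i.
  apply: measurable_funTS; apply: continuous_measurable_rV.
  exact: Cc_infty_continuous_partial (u_test_Cc_infty (e0 k)).
have [] := @singular_dominated R n n3 einv (ltW einv_lt1)
  (fun k x => enorm (grad_u x - grad (u_test (e k)) x) ^+ 2) (fun=> 0) 1.
- move=> k; under eq_fun do rewrite sqr_enorm.
  by apply: measurable_sum => i; exact: measurable_funM.
- exact: measurable_cst.
- move=> x Dx x0.
  rewrite (_ : (fun k => _) = (fun k => (u_slope (dotrv x x) -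
    u_slope (dotrv x x + e k) * u_test_factor (e k) x) ^+ 2 * dotrv x x)); last first.
    by apply/funext => k; rewrite grad_diff sqr_enorm dotrvZ -expr2.
  rewrite -[X in _ --> X](mul0r (dotrv x x)); apply: cvgMr_tmp.
  rewrite -[X in _ --> X](mulr0 0); under eq_fun do rewrite expr2.
  have c : u_slope (dotrv x x) - u_slope (dotrv x x + e k) * u_test_factor (e k) x
      @[k --> \oo] --> (0 : R).
    rewrite -[X in _ --> X](subrr (u_slope (dotrv x x))); apply: cvgB; first exact: cvg_cst.
    rewrite -[X in _ --> X]mulr1; apply: cvgM; last exact: u_test_factor_cvg.
    exact: (profile_cvg (is_derive_u_slope (dot_gt0 x0))).
  exact: cvgM.
- move=> k x Dx x0; rewrite grad_diff ger0_norm ?sqr_ge0// enormZ exprMn mul1r sqr_enorm.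
  have qx := dot_gt0 x0; set q := dotrv x x in qx *.
  have /andP[f0 f1] := u_test_factor_itv (e0 k) x.
  have qe : 0 < q + e k by rewrite addr_gt0.
  have h1 : 0 <= u_test_factor (e k) x / (q + e k) <= q^-1.
    apply/andP; split; first by rewrite divr_ge0// ltW.
    apply: (@le_trans _ _ (q + e k)^-1).
      by rewrite ler_piMl// invr_ge0 ltW.
    by rewrite lef_pV2 ?posrE// lerDl ltW.
  (* Both terms lie in [[- 1/q, 0]], hence so small a difference; squared and multiplied by
     [|x|^2 = q] it gives the majorant [1/q]. *)
  have k1 : `|u_slope q - u_slope (q + e k) * u_test_factor (e k) x| <= q^-1.
    rewrite /u_slope mulNr opprK (mulrC _ (u_test_factor _ _)) ler_norml.
    by move: h1 => /andP[? ?]; apply/andP; split; lra.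
  apply: (@le_trans _ _ (q^-1 ^+ 2 * q)).
    apply: ler_wpM2r; first exact: ltW.
    by apply: lerXn2r => //; rewrite nnegrE// invr_ge0 ltW.
  by rewrite expr2 -mulrA mulVf ?mulr1// gt_eqF.
- move=> _; rewrite integral0_eq//.
Qed.

Lemma L2_u_test_cvg :
  (\int[mu]_(x in D) ((u_ex x - u_test (e k) x) ^+ 2)%:E @[k --> \oo] --> 0)%E.
Proof.
have [] := @singular_dominated R n n3 einv (ltW einv_lt1)
  (fun k x => (u_ex x - u_test (e k) x) ^+ 2) (fun=> 0) 4.
- move=> k; apply: measurable_funX; apply: measurable_funB.
    by rewrite u_exE; exact: measurable_radial (@measurable_u_profile R).
  apply: measurable_funTS; apply: continuous_measurable_rV.
  exact: Cc_infty_continuous (u_test_Cc_infty (e0 k)).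
- exact: measurable_cst.
- move=> x Dx x0; rewrite -[X in _ --> X](mulr0 0); under eq_fun do rewrite expr2.
  have c : u_ex x - u_test (e k) x @[k --> \oo] --> (0 : R).
    rewrite -[X in _ --> X](subrr (u_ex x)); apply: cvgB; first exact: cvg_cst.
    exact: u_test_cvg.
  exact: cvgM.
- move=> k x Dx x0; have /andP[t0 t1] := u_test_itv (e0 k) x0 Dx.
  rewrite ger0_norm ?sqr_ge0//.
  (* From [0 <= u_test <= u]; the constant 4 is that of the bound on [u^2]. *)
  apply: (@le_trans _ _ (u_ex x ^+ 2)).
    by rewrite lerXn2r ?nnegrE; lra.
  rewrite u_exE sqr_enorm; apply: u_profile_sqr_le; rewrite dot_gt0//=.
  rewrite -sqr_enorm; apply: lt_trans sqr_einv_lt.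
  by rewrite ltrXn2r// enorm_ge0.
- move=> _; rewrite integral0_eq//.
Qed.

End regularization_limits.

Lemma W12_0_u (R : realType) n : (3 <= n)%N ->
  W12_0 (eball einv) (u_ex : 'rV[R]_n -> R).
Proof.
move=> n3; exists (@grad_u R n); first exact: W12_with_u.
move=> eps eps0.
pose e (k : nat) : R := 1 / k.+2%:R.
have e0 k : 0 < e k by rewrite divr_gt0.
have ecv : e k @[k --> \oo] --> (0 : R) by exact: cvg_div_natSS.
have cv : (\int[lebesgue_rV R n]_(x in eball einv) ((u_ex x - u_test (e k) x) ^+ 2)%:E +
  \int[lebesgue_rV R n]_(x in eball einv)
    (enorm (grad_u x - grad (u_test (e k)) x) ^+ 2)%:E @[k --> \oo] --> 0)%E.
  rewrite -[X in _ --> X]adde0; apply: cvgeD; first by [].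
    exact: (L2_u_test_cvg n3 e0 ecv).
  exact: (dirichlet_u_test_cvg n3 e0 ecv).
have e2 : (0 < (eps ^+ 2)%:E)%E by rewrite lte_fin exprn_gt0.
have nb : nbhs (0%E : \bar R) [set y | (y < (eps ^+ 2)%:E)%E].
  by apply: open_nbhs_nbhs; split => //; exact: open_ereal_lt_ereal.
have [k _ /(_ k (leqnn k)) hk] := cv _ nb.
exists (u_test (e k)); first exact: u_test_Cc_infty.
rewrite /W12_norm; move: hk; set I := (_ + _)%E => hk.
have I0 : (0 <= I)%E.
  by apply: adde_ge0; apply: integral_ge0 => x _; rewrite lee_fin sqr_ge0.
have If : I \is a fin_num by rewrite ge0_fin_numE//; apply: lt_trans hk _; exact: ltry.
have hk' : fine I < eps ^+ 2 by rewrite -lte_fin fineK.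
rewrite -(fineK If) poweR_EFin lte_fin.
rewrite -[ltRHS](_ : (eps ^+ 2) `^ 2^-1 = eps).
  by apply: gt0_ltr_powR => //; rewrite nnegrE ?sqr_ge0// fine_ge0.
by rewrite powR12_sqrt ?sqr_ge0// sqrtr_sqr gtr0_norm.
Qed.

Theorem mainTheorem17 (R : realType) (n : nat) (hn : (3 <= n)%N) :
  let mu := lebesgue_rV R n in
  let B : R -> set 'rV[R]_n := eball in
  let B1e := B einv in
  [/\
    (* (i) *)
    [/\ W12_0 B1e u_ex, weak_Ln B1e c_ex, weak_solution B1e c_ex u_ex
      & ~ ess_bounded B1e u_ex],
    (* (ii) *)
    [/\ W12 B1e v_ex, weak_Ln B1e c'_ex, weak_solution B1e c'_ex v_ex,
        v_ex x @[x --> (0 : 'rV[R]_n)^'] --> (0 : R)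
      & forall r : R, 0 < r -> ~ (\forall x \ae mu, B r x -> v_ex x = 0)],
    (* boundedness of solutions fails, also locally and for nonnegative
       solutions with zero boundary values *)
    exists (c : 'rV[R]_n -> 'rV[R]_n) (u : 'rV[R]_n -> R),
      [/\ weak_Ln B1e c, W12_0 B1e u, weak_solution B1e c u,
          \forall x \ae mu, B1e x -> 0 <= u x
        & forall r : R, 0 < r <= einv -> ~ ess_bounded (B r) u]
    & (* the reverse Moser estimate fails *)
    exists (c : 'rV[R]_n -> 'rV[R]_n) (w : 'rV[R]_n -> R),
      [/\ weak_Ln B1e c, W12 B1e w, weak_supersolution B1e c w,
          \forall x \ae mu, B1e x -> 0 <= w x
        & forall a C r : R, 0 < a -> 0 < r <= einv ->
            ~ (power_mean a (B r) w <= C%:E * ess_inf_on (B (r / 2)%R) w)%E]].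
Proof.
move=> mu B B1e; have n0 : (0 < n)%N by exact: leq_trans hn.
have W12v : W12 B1e v_ex by exists grad_v; exact: W12_with_v.
split.
- split; [exact: W12_0_u|exact: weak_Ln_c_ex|exact: weak_solution_u|].
  by apply: u_ex_unbounded => //; exact: einv_gt0.
- split=> //; [exact: weak_Ln_c'_ex|exact: weak_solution_v|exact: v_ex_cvg0|].
  by move=> r; exact: v_ex_nonzero.
- exists c_ex, u_ex; split.
  + exact: weak_Ln_c_ex.
  + exact: W12_0_u.
  + exact: weak_solution_u.
  + by apply: filterS (ae_neq0 n0) => x; exact: u_ex_ge0.
  + by move=> r /andP[r0 _]; exact: u_ex_unbounded.
- exists c'_ex, v_ex; split => //.
  + exact: weak_Ln_c'_ex.
  + exists grad_v; first by have [] := W12_with_v (R := R) hn.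
    (* A solution is a supersolution: the integral is 0 for every test function. *)
    by move=> phi h _; have [i0 ->] := weak_form_v hn h.
  + by apply: filterS (ae_neq0 n0) => x x0 Dx; apply: ltW; exact: v_ex_gt0.
  + move=> a C r a0 r0; have /andP[rgt0 re] := r0.
    (* The infimum over the half ball is 0, so the right side is [C * 0 = 0] for every real [C],
       against a positive mean. *)
    rewrite ess_inf_v_ex//; last first.
      rewrite divr_gt0//=; apply: le_trans re; rewrite ler_pdivrMr// ler_peMr ?ler1n//.
      exact: ltW.
    by apply/negP; rewrite -ltNge mule0; exact: power_mean_v_ex_gt0.
Qed.
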